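(* Let $n\geq 1$ be an odd integer. Then there exists a cellular biembedding of $K_{(n^2+1)\times 2}$ into an orientable surface such that every face has length $4n$ or a multiple of $n\frac{n^2+1}{2}$.
   Context: $K_{q\times r}$ denotes the complete multipartite graph with $q$ parts each of size $r$. An embedding of a graph $\Gamma$ (as a $1$-dimensional simplicial complex) in a surface $\Sigma$ is a continuous injective map $\phi:\Gamma\to\Sigma$; the connected components of $\Sigma\setminus\phi(\Gamma)$ are its faces; the embedding is cellular if every face is homeomorphic to an open disc. A circuit decomposition of a graph is a set of circuits (closed trails, without repeated edges but possibly with repeated vertices) whose edge-sets partition the edge-set. A biembedding of two circuit decompositions $\mathcal{D},\mathcal{D}'$ of a simple graph $\Gamma$ is a face $2$-colorable embedding of $\Gamma$ in which (the boundaries of the faces of) one color class are the circuits of $\mathcal{D}$ and those of the other color class are the circuits of $\mathcal{D}'$. A biembedding of $\Gamma$ means a biembedding of some two circuit decompositions of $\Gamma$. The length of a face is the number of edges of its boundary circuit. *)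

(* Defs.v *)
From HB Require Import structures.
From mathcomp Require Import all_boot all_order all_algebra.
From mathcomp Require Import all_classical all_reals all_analysis.
Import Order.TTheory GRing.Theory Num.Theory.
Import numFieldNormedType.Exports.

Set Implicit Arguments.
Unset Strict Implicit.
Unset Printing Implicit Defensive.

Local Open Scope classical_set_scope.
Local Open Scope ring_scope.

(** * Graphs and circuit decompositions *)

Section Graphs.
Variable V : finType.
Implicit Types (adj : rel V) (C : seq V) (D : seq (seq V)).

Definition edges adj : {set {set V}} :=
  [set [set p.1; p.2] | p : V * V & adj p.1 p.2]%SET.

(* A closed walk is given by the sequence v_0, ..., v_{L-1} of its vertices,
   the last step going from v_{L-1} back to v_0. *)
Definition walk_edges C : seq {set V} :=
  [seq [set p.1; p.2]%SET | p <- zip C (rot 1 C)].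

Definition circuit adj C : bool :=
  [&& C != [::], cycle adj C & uniq (walk_edges C)].

Definition circuit_decomposition adj D : bool :=
  all (circuit adj) D &&
  perm_eq (flatten (map walk_edges D)) (enum (edges adj)).

End Graphs.

(* K_{q x r}: vertex (i, a) is the a-th vertex of the i-th part. *)
Definition multipartite (q r : nat) : rel ('I_q * 'I_r) :=
  fun x y => x.1 != y.1.

(** * Surfaces *)

Section Surfaces.
Variable R : realType.

Definition homeo_between (X Y : topologicalType) (A : set X) (B : set Y)
    (f : X -> Y) (g : Y -> X) : Prop :=
  [/\ {homo f : x / A x >-> B x}, {homo g : y / B y >-> A y},
      (forall x, A x -> g (f x) = x), (forall y, B y -> f (g y) = y) &
      {within A, continuous f} /\ {within B, continuous g}].

Definition homeomorphic (X Y : topologicalType) (A : set X) (B : set Y) : Prop :=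
  exists f g, homeo_between A B f g.

Definition open_disc : set (R * R) := [set z | z.1 ^+ 2 + z.2 ^+ 2 < 1].

Record chart (S : topologicalType) := Chart {
  chart_dom : set S;
  chart_cod : set (R * R);
  chart_map : S -> R * R;
  chart_inv : R * R -> S;
  chart_dom_open : open chart_dom;
  chart_cod_open : open chart_cod;
  chart_homeo : homeo_between chart_dom chart_cod chart_map chart_inv }.

(* Closed connected surface; second countability follows from compactness. *)
Definition surface (S : topologicalType) : Prop :=
  [/\ hausdorff_space S, compact [set: S], connected [set: S] &
      forall x : S, exists c : chart S, chart_dom c x].

(* The loop gamma : [0, 2 pi] -> R^2 avoids the origin and has winding number
   w around it: theta is a continuous determination of its argument. *)
Definition winding_number (gamma : R -> R * R) (w : int) : Prop :=
  exists rho theta : R -> R,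
    [/\ {within `[0, 2 * pi]%classic, continuous theta},
        forall t, t \in `[0, 2 * pi] -> 0 < rho t,
        forall t, t \in `[0, 2 * pi] ->
          gamma t = (rho t * cos (theta t), rho t * sin (theta t)) &
        theta (2 * pi) - theta 0 = 2 * pi * w%:~R].

(* Local degree +1 at p: h sends every small positively oriented circle
   around p to a loop winding once, positively, around h p. *)
Definition orientation_preserving_at (h : R * R -> R * R) (p : R * R) : Prop :=
  \forall r \near 0^'+,
    winding_number (fun t => h (p + (r * cos t, r * sin t)) - h p) 1.

Definition orientable (S : topologicalType) : Prop :=
  exists A : set (chart S),
    (forall x, exists2 c, A c & chart_dom c x) /\
    (forall c c', A c -> A c' -> forall x, chart_dom c x -> chart_dom c' x ->
       orientation_preserving_at (chart_map c' \o chart_inv c) (chart_map c x)).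

(** * Embeddings *)

Section Embeddings.
Variables (V : finType) (adj : rel V).

(* Geometric realization of the graph as a 1-dimensional simplicial complex,
   in barycentric coordinates. *)
Definition cell (e : {set V}) : set {ptws V -> R} :=
  [set x | [/\ forall v, 0 <= x v, \sum_v x v = 1 &
               forall v, v \notin e -> x v = 0]].

Definition realization : set {ptws V -> R} :=
  [set x | (exists v, cell [set v]%SET x) \/
           (exists2 e, e \in edges adj & cell e x)].

Definition edge_point (u v : V) (s : R) : {ptws V -> R} :=
  fun w => (1 - s) * (w == u)%:R + s * (w == v)%:R.

Variable S : topologicalType.
Implicit Types (phi : {ptws V -> R} -> S) (F G : set S) (C : seq V).

Definition embedding phi : Prop :=
  {within realization, continuous phi} /\ set_inj realization phi.

Definition face phi F : Prop :=
  exists2 x, (~` (phi @` realization)) x &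
    F = connected_component (~` (phi @` realization)) x.

Definition cellular phi : Prop :=
  forall F, face phi F -> homeomorphic F open_disc.

(* The regular L-gon inscribed in the unit circle and its k-th corner
   (k being read modulo L). *)
Definition corner (L k : nat) : R * R :=
  (cos (2 * pi * k%:R / L%:R), sin (2 * pi * k%:R / L%:R)).

Definition polygon (L : nat) : set (R * R) :=
  [set z | exists a : 'I_L -> R,
     [/\ forall k, 0 <= a k, \sum_k a k = 1,
         z.1 = \sum_k a k * (corner L k).1 &
         z.2 = \sum_k a k * (corner L k).2]].

Definition side_point (L k : nat) (s : R) : R * R :=
  ((1 - s) * (corner L k).1 + s * (corner L k.+1).1,
   (1 - s) * (corner L k).2 + s * (corner L k.+1).2).

(* The face F is bounded by the closed walk C, of length L: F is the
   homeomorphic image of the interior of an L-gon under a continuous map whose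
   restriction to the boundary of the L-gon runs along C, side by side. *)
Definition bounded_by phi F C : Prop :=
  let L := size C in
  exists g : R * R -> S,
    [/\ {within polygon L, continuous g},
        exists g', homeo_between (interior (polygon L)) F g g' &
        forall (v0 : V) (k : nat) (s : R), (k < L)%N -> s \in `[0, 1] ->
          g (side_point L k s) =
          phi (edge_point (nth v0 C k) (nth v0 (rot 1 C) k) s)].

Definition face_length phi F (l : nat) : Prop :=
  exists C, [/\ circuit adj C, bounded_by phi F C & size C = l].

Definition share_edge phi F G : Prop :=
  exists2 e, e \in edges adj & phi @` cell e `<=` closure F `&` closure G.

Definition face_coloring phi (col : set S -> bool) : Prop :=
  forall F G, face phi F -> face phi G -> F <> G -> share_edge phi F G ->
    col F <> col G.

Definition class_boundaries phi (col : set S -> bool) (b : bool)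
    (D : seq (seq V)) : Prop :=
  (forall F, face phi F -> col F = b -> exists2 C, C \in D & bounded_by phi F C) /\
  (forall C, C \in D -> exists F, [/\ face phi F, col F = b & bounded_by phi F C]).

Definition biembedding phi (D D' : seq (seq V)) : Prop :=
  [/\ embedding phi, circuit_decomposition adj D, circuit_decomposition adj D' &
      exists col, [/\ face_coloring phi col, class_boundaries phi col true D &
                      class_boundaries phi col false D']].

End Embeddings.
End Surfaces.

(* Main.v *)
(* Up to sign, the residues modulo N = 2n^2 + 2 other than 0 and N/2 are 1, ...,
   n^2, and as n is odd they can be given signs that make their sum equal to 1.
   Following these signed labels cyclically from residue to residue, one moves by
   1 in each turn, hence runs through all N n^2 edges of K_{(n^2+1) x 2} before
   closing up: this is an Eulerian circuit. Following every second label (n^2 is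
   odd) gives another one, which orients every edge in the same way. Around each
   vertex the two circuits pass from the incoming arc with label r to the one with
   label r + 1, in a single cycle; so gluing one disc along each circuit yields a
   closed surface. It is orientable and has only two faces, each of length
   N n^2 = 4n (n (n^2 + 1) / 2).

   The surface is realized by coning the two discs from their centres, inside a
   finite-dimensional space. The open star of each vertex of the resulting
   triangulation is mapped piecewise linearly to a regular polygon. A transition
   between two such charts is, up to rotations, (a, b) |-> (a + kappa |b|, mu b)
   with mu > 0; it never moves two points in exactly opposite directions, whence
   the local degree 1. *)

(* Each circuit passes n^2 times through every vertex, so that n^2 edges join a disc centre to each
   vertex: for n > 1 the coned triangulation is not a simplicial complex, and vertex weights alone
   do not separate its points. Hence the extra coordinates of the ambient space, which record for
   each edge the product of the weights at its ends. Dividing these products by the weight of a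
   vertex gives back the position in its star, so a chart and its inverse both have explicit
   formulas.

   The cycle at a vertex arises as follows. After the incoming arc with the r-th label, the white
   circuit leaves along the arc with label number r + 2; the black circuit reaches that same
   outgoing arc from the incoming arc with label number r + 1.

   Both circuits traverse an arc in its own direction. The white disc is therefore glued along its
   circuit read backwards; the two triangles at an edge then induce opposite directions on it, which
   is what makes the gluing oriented. *)
Require Import Defs.
From HB Require Import structures.
From mathcomp Require Import all_boot all_order all_algebra.
From mathcomp Require Import all_classical all_reals all_analysis.
From mathcomp Require Import ring lra zify.
Import Order.TTheory GRing.Theory Num.Theory.
Import numFieldNormedType.Exports.

Set Implicit Arguments.
Unset Strict Implicit.
Unset Printing Implicit Defensive.

Local Open Scope classical_set_scope.
Local Open Scope ring_scope.

(** * Continuity of real functions *)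

Section Continuity.
Variables (R : realType) (T : topologicalType).
Implicit Types f g : T -> R.

(* A constant, so that [prove_continuous] can match on the shape of [f]. *)
Definition real_continuous f : Prop := continuous f.

Lemma real_continuousD f g : real_continuous f -> real_continuous g ->
  real_continuous (fun x => f x + g x).
Proof. by move=> cf cg x; exact: (cvgD (cf x) (cg x)). Qed.

Lemma real_continuousN f : real_continuous f -> real_continuous (fun x => - f x).
Proof. by move=> cf x; exact: (cvgN (cf x)). Qed.

Lemma real_continuousM f g : real_continuous f -> real_continuous g ->
  real_continuous (fun x => f x * g x).
Proof. by move=> cf cg x; exact: (cvgM (cf x) (cg x)). Qed.

Lemma real_continuousV f : (forall x, f x != 0) -> real_continuous f ->
  real_continuous (fun x => (f x)^-1).
Proof. by move=> f0 cf x; exact: (cvgV (f0 x) (cf x)). Qed.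

Lemma real_continuous_max f g : real_continuous f -> real_continuous g ->
  real_continuous (fun x => Num.max (f x) (g x)).
Proof. by move=> cf cg x; apply: continuous_max; [exact: cf|exact: cg]. Qed.

Lemma real_continuous_min f g : real_continuous f -> real_continuous g ->
  real_continuous (fun x => Num.min (f x) (g x)).
Proof. by move=> cf cg x; apply: continuous_min; [exact: cf|exact: cg]. Qed.

Lemma real_continuous_cst (c : R) : real_continuous (fun _ : T => c).
Proof. by move=> x; apply: cvg_cst. Qed.

Lemma real_continuousX f n : real_continuous f ->
  real_continuous (fun x => f x ^+ n).
Proof.
move=> cf; elim: n => [|n IH]; first exact: real_continuous_cst.
under [X in real_continuous X]eq_fun do rewrite exprS.
exact: real_continuousM.
Qed.

Lemma real_continuous_norm f : real_continuous f ->
  real_continuous (fun x => `|f x|).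
Proof. by move=> cf x; apply: cvg_norm; apply: cf. Qed.

Lemma real_continuous_comp (h : R -> R) f : continuous h -> real_continuous f ->
  real_continuous (fun x => h (f x)).
Proof. by move=> ch cf x; apply: continuous_comp; [exact: cf|exact: ch]. Qed.

Lemma real_continuous_sum (I : finType) (F : I -> T -> R) :
  (forall i, real_continuous (F i)) -> real_continuous (fun x => \sum_i F i x).
Proof.
move=> cF x; apply: cvg_big => [|i _]; last exact: cF.
by move=> z; exact: (cvgD cvg_fst cvg_snd).
Qed.

Lemma closed_real_le f (c : R) : real_continuous f -> closed [set x | f x <= c].
Proof.
by move=> cf; exact: (@preimage_closed _ _ f _ (fun x _ => cf x) (@closed_le R c)).
Qed.

Lemma open_real_lt f (c : R) : real_continuous f -> open [set x | f x < c].
Proof.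
by move=> cf; exact: (@open_comp _ _ f _ (fun x _ => cf x) (@open_lt R c)).
Qed.

Lemma open_real_gt f (c : R) : real_continuous f -> open [set x | c < f x].
Proof.
by move=> cf; exact: (@open_comp _ _ f _ (fun x _ => cf x) (@open_gt R c)).
Qed.

Lemma continuous_pair f g : real_continuous f -> real_continuous g ->
  continuous (fun x => (f x, g x)).
Proof. by move=> cf cg x; exact: (cvg_pair (cf x) (cg x)). Qed.

End Continuity.

Lemma real_continuous_id (R : realType) : real_continuous (fun x : R => x).
Proof. by move=> z; exact: cvg_id. Qed.

Lemma real_continuous_fst (R : realType) : real_continuous (fun z : R * R => z.1).
Proof. by move=> z; exact: cvg_fst. Qed.

Lemma real_continuous_snd (R : realType) : real_continuous (fun z : R * R => z.2).
Proof. by move=> z; exact: cvg_snd. Qed.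

Ltac prove_continuous :=
  lazymatch goal with
  | |- real_continuous (fun x => GRing.add (@?f x) (@?g x)) =>
      apply (@real_continuousD _ _ f g); prove_continuous
  | |- real_continuous (fun x => GRing.opp (@?f x)) =>
      apply (@real_continuousN _ _ f); prove_continuous
  | |- real_continuous (fun x => GRing.mul (@?f x) (@?g x)) =>
      apply (@real_continuousM _ _ f g); prove_continuous
  | |- real_continuous (fun x => GRing.exp (@?f x) ?n) =>
      apply (@real_continuousX _ _ f n); prove_continuous
  | |- real_continuous (fun x => Num.max (@?f x) (@?g x)) =>
      apply (@real_continuous_max _ _ f g); prove_continuous
  | |- real_continuous (fun x => Num.min (@?f x) (@?g x)) =>
      apply (@real_continuous_min _ _ f g); prove_continuous
  | |- real_continuous (fun x => Num.norm (@?f x)) =>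
      apply (@real_continuous_norm _ _ f); prove_continuous
  | |- real_continuous (fun x => Num.sqrt (@?f x)) =>
      apply (@real_continuous_comp _ _ _ f (@sqrt_continuous _)); prove_continuous
  | |- real_continuous (fun x => cos (@?f x)) =>
      apply (@real_continuous_comp _ _ _ f (@continuous_cos _)); prove_continuous
  | |- real_continuous (fun x => sin (@?f x)) =>
      apply (@real_continuous_comp _ _ _ f (@continuous_sin _)); prove_continuous
  | |- real_continuous (fun x => atan (@?f x)) =>
      apply (@real_continuous_comp _ _ _ f (@continuous_atan _)); prove_continuous
  | |- real_continuous (fun x => \sum_i (@?f x i)) =>
      apply (@real_continuous_sum _ _ _ (fun i x => f x i)) => ?; prove_continuous
  | |- real_continuous (fun x => fst x) => apply real_continuous_fst
  | |- real_continuous (fun x => snd x) => apply real_continuous_snd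
  | |- real_continuous (fun x => x) => apply real_continuous_id
  | |- real_continuous (fun _ => ?c) => apply real_continuous_cst
  | |- _ => try assumption
  end.

(** * Trigonometry *)

Section Trigonometry.
Variable R : realType.
Implicit Types x y : R.

Lemma sin_le0_pi x : pi <= x <= 2 * pi -> sin x <= 0.
Proof.
move=> /andP[x1 x2]; have -> : x = (x - pi) + pi by ring.
by rewrite sinDpi oppr_le0 sin_ge0_pi//; apply/andP; split; lra.
Qed.

Lemma polar (z : R * R) : exists r t : R, [/\ 0 <= r, 0 <= t < 2 * pi &
  z = (r * cos t, r * sin t)].
Proof.
have pi0 := pi_gt0 R.
case: z => x y; set r := Num.sqrt (x ^+ 2 + y ^+ 2).
have s0 : 0 <= x ^+ 2 + y ^+ 2 by rewrite addr_ge0 ?sqr_ge0.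
have r0 : 0 <= r by rewrite sqrtr_ge0.
have r2 : r ^+ 2 = x ^+ 2 + y ^+ 2 by rewrite sqr_sqrtr.
have [re|rn] := eqVneq r 0.
  exists 0, 0; split => //; first by apply/andP; split; lra.
  move: r2; rewrite re expr0n/= => /esym/eqP.
  by rewrite paddr_eq0 ?sqr_ge0// !sqrf_eq0 => /andP[/eqP-> /eqP->]; rewrite !mul0r.
have rp : 0 < r by rewrite lt_def rn.
set c := x / r.
have c2 : c ^+ 2 + (y / r) ^+ 2 = 1.
  by rewrite /c !expr_div_n -mulrDl -r2 divff// sqrf_eq0.
have c1 : -1 <= c <= 1.
  by rewrite -ler_norml -(@ler_pXn2r _ 2)// ?nnegrE// real_normK ?num_real// expr1n -c2 lerDl sqr_ge0.
have xE : r * c = x by rewrite /c mulrC divfK.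
have yE : r * Num.sqrt (1 - c ^+ 2) = `|y|.
  have -> : 1 - c ^+ 2 = (y / r) ^+ 2 by rewrite -c2; ring.
  by rewrite sqrtr_sqr normrM normfV (ger0_norm r0) mulrC divfK.
have [y0|y0] := leP 0 y.
  exists r, (acos c); split => //.
    by rewrite acos_ge0//= (le_lt_trans (acos_lepi c1))//; lra.
  by rewrite acosK ?in_itv// sin_acos// xE yE ger0_norm.
(* Now [y < 0]. The angle stays below [2 * pi] because [acos c] is positive: [c = 1] would force
   [y = 0]. *)
exists r, (2 * pi - acos c); split => //.
  have := acos_lepi c1; have : 0 < acos c.
    apply: acos_gt0; case/andP: c1 => -> c1; rewrite lt_def c1 andbT/=.
    apply/eqP => ce; move: c2; rewrite -ce expr1n => c2.
    have /eqP : (y / r) ^+ 2 = 0 by lra.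
    rewrite sqrf_eq0 mulf_eq0 invr_eq0 (negPf rn) orbF.
    by rewrite lt_eqF.
  by move=> ? ?; apply/andP; split; lra.
have -> : 2 * pi - acos c = - acos c + pi *+ 2 by rewrite -mulr_natl; ring.
by rewrite cosD2pi sinD2pi cosN sinN acosK ?in_itv// sin_acos// mulrN xE yE ltr0_norm// opprK.
Qed.

End Trigonometry.

(** * Piecewise linear coordinates on a regular polygon *)

Section Hats.
Variable R : realType.
Implicit Types (d i k m : nat) (a b : R) (z : R * R).

Definition central_angle d : R := 2 * pi / d%:R.

Definition det (z w : R * R) : R := z.1 * w.2 - z.2 * w.1.

Definition sect d k a b : R * R :=
  (a * (corner R d k).1 + b * (corner R d k.+1).1,
   a * (corner R d k).2 + b * (corner R d k.+1).2).

(* The piecewise linear function equal to 1 at corner [k] and to 0 at the other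
   corners and at the origin; this formula for it fails when [d = 3]. *)
Definition hat d k z : R :=
  Num.max 0 (Num.min (det z (corner R d k.+1)) (det (corner R d (k + d.-1)) z))
  / sin (central_angle d).

(** For [4 <= d] this is the Minkowski functional of the regular [d]-gon: in the sector between two
    consecutive corners it is the sum of the two coefficients. *)
Definition gauge d z : R := \sum_(i < d) hat d i z.

Lemma continuous_hat d k : real_continuous (hat d k).
Proof. rewrite /hat /det; prove_continuous. Qed.

Lemma continuous_gauge d : real_continuous (gauge d).
Proof. by apply: real_continuous_sum => i; exact: continuous_hat. Qed.

Lemma cornerE d k :
  corner R d k = (cos (k%:R * central_angle d), sin (k%:R * central_angle d)).
Proof. by rewrite /corner /central_angle; congr (cos _, sin _); ring. Qed.

Lemma det_corner d i k :
  det (corner R d i) (corner R d k) = sin ((k%:R - i%:R) * central_angle d).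
Proof. by rewrite !cornerE /det/= mulrBl sinB; ring. Qed.

Lemma detZDl a b z w x : det (a * z.1 + b * w.1, a * z.2 + b * w.2) x =
  a * det z x + b * det w x.
Proof. by rewrite /det/=; ring. Qed.

Lemma detZDr a b z w x : det x (a * z.1 + b * w.1, a * z.2 + b * w.2) =
  a * det x z + b * det x w.
Proof. by rewrite /det/=; ring. Qed.

Lemma mulr_central_angle d : (0 < d)%N -> d%:R * central_angle d = 2 * pi.
Proof. by move=> d0; rewrite /central_angle mulrC divfK// pnatr_eq0 -lt0n. Qed.

Lemma central_angle_gt0 d : (0 < d)%N -> 0 < central_angle d.
Proof. by move=> d0; rewrite divr_gt0 ?mulr_gt0 ?pi_gt0 ?ltr0n. Qed.

Lemma corner_periodic d k : (0 < d)%N -> corner R d (k + d) = corner R d k.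
Proof.
move=> d0; rewrite !cornerE natrD mulrDl mulr_central_angle// [2 * pi]mulr_natl.
by rewrite cosD2pi sinD2pi.
Qed.

Lemma corner_mod d k : (0 < d)%N -> corner R d (k %% d) = corner R d k.
Proof.
move=> d0; rewrite {2}(divn_eq k d) addnC; elim: (k %/ d)%N => [|q IH].
  by rewrite mul0n addn0.
by rewrite IH mulSn (addnC d) addnA corner_periodic.
Qed.

Lemma sect_mod d k a b : (0 < d)%N -> sect d (k %% d) a b = sect d k a b.
Proof.
move=> d0; rewrite /sect corner_mod// -(corner_mod (k %% d).+1 d0) -(corner_mod k.+1 d0).
by rewrite -(addn1 (k %% d)) modnDml addn1.
Qed.

Section GoodSize.
Variable d : nat.
Hypothesis d4 : (4 <= d)%N.
Let d0 : (0 < d)%N. Proof. exact: leq_trans d4. Qed.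
Local Notation delta := (central_angle d).

Lemma natr_central_angle m : (m <= d)%N -> m%:R * delta <= 2 * pi.
Proof.
by move=> md; rewrite -(mulr_central_angle d0) ler_pM2r ?central_angle_gt0// ler_nat.
Qed.

Lemma central_angle_le : delta *+ 2 <= pi.
Proof.
by have := natr_central_angle d4; lra.
Qed.

Lemma sin_central_angle_gt0 : 0 < sin delta.
Proof.
have := central_angle_le; have := central_angle_gt0 d0; have := pi_gt0 R.
by move=> ? ? ?; apply: sin_gt0_pi; apply/andP; split; lra.
Qed.

Lemma sin_central_angle2_ge0 : 0 <= sin (delta *+ 2).
Proof.
apply: sin_ge0_pi; rewrite central_angle_le mulrn_wge0//.
by rewrite ltW// central_angle_gt0.
Qed.

(** In the sectors not adjacent to corner [i], one of the two determinants is nonpositive: the first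
    if [m * delta <= pi], the second otherwise. In the two adjacent sectors the minimum picks the
    right determinant because [sin (2 * delta) >= 0], which is where [4 <= d] enters. *)
Lemma hat_sect i m a b : (m < d)%N -> 0 <= a -> 0 <= b ->
  hat d i (sect d (i + m) a b) =
  if m == 0%N then a else if m == d.-1 then b else 0.
Proof.
move=> md a0 b0; have s0 := sin_central_angle_gt0.
have s2 := sin_central_angle2_ge0; have de0 := central_angle_gt0 d0.
have dd := mulr_central_angle d0; have pi0 := pi_gt0 R.
rewrite /hat /sect detZDl detZDr !det_corner.
have dpE : (d.-1)%:R = d%:R - 1 :> R by rewrite -{2}(prednK d0) -natr1 addrK.
have -> : (i.+1%:R - (i + m)%:R) * delta = - ((m%:R - 1) * delta).
  by rewrite natrD -natr1; ring.
have -> : (i.+1%:R - (i + m).+1%:R) * delta = - (m%:R * delta).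
  by rewrite -!natr1 natrD; ring.
have -> : ((i + m)%:R - (i + d.-1)%:R) * delta = (m%:R + 1) * delta - 2 * pi.
  by rewrite !natrD dpE -dd; ring.
have -> : ((i + m).+1%:R - (i + d.-1)%:R) * delta = (m%:R + 2) * delta - 2 * pi.
  by rewrite -(natr1 (i + m)) !natrD dpE -dd; ring.
have sinp (x : R) : sin (x + 2 * pi) = sin x by rewrite mulr_natl sinD2pi.
have sin2 (x : R) : sin (x - 2 * pi) = sin x by rewrite -[RHS]sinp -sinp !subrK.
rewrite !sin2 !sinN; have [->|m0] := eqVneq m 0%N.
  rewrite !mul0r sin0 oppr0 mulr0 addr0 !add0r mul1r mulN1r sinN opprK mulr_natl.
  rewrite (min_idPl _) ?lerDl ?mulr_ge0//.
  by rewrite (max_idPr _) ?mulr_ge0 ?(ltW s0)// mulfK// gt_eqF.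
have [->|m1] := eqVneq m d.-1.
  have -> : ((d.-1)%:R - 1) * delta = - (delta *+ 2) + 2 * pi.
    by rewrite dpE -dd -mulr_natl; ring.
  have -> : (d.-1)%:R * delta = - delta + 2 * pi by rewrite dpE -dd; ring.
  have -> : ((d.-1)%:R + 1) * delta = 0 + 2 * pi by rewrite dpE -dd; ring.
  have -> : ((d.-1)%:R + 2) * delta = delta + 2 * pi by rewrite dpE -dd; ring.
  rewrite !sinp sin0 mulr0 add0r !sinN !opprK.
  rewrite (min_idPr _) ?lerDr ?mulr_ge0//.
  by rewrite (max_idPr _) ?mulr_ge0 ?(ltW s0)// mulfK// gt_eqF.
have m1d : (m.+2 <= d)%N by lia.
have m1R : 1 <= m%:R :> R by rewrite ler1n; lia.
have m2R : (m%:R + 2) * delta <= 2 * pi.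
  by have := natr_central_angle m1d; rewrite -addn2 natrD.
rewrite (max_idPl _) ?mul0r// ge_min; have [mpi|mpi] := leP (m%:R * delta) pi.
  have h1 : 0 <= a * sin ((m%:R - 1) * delta).
    rewrite mulr_ge0// sin_ge0_pi//; apply/andP; split; last lra.
    by rewrite mulr_ge0 ?(ltW de0)//; lra.
  have h2 : 0 <= b * sin (m%:R * delta).
    by rewrite mulr_ge0// sin_ge0_pi// mpi mulr_ge0// ltW.
  by apply/orP; left; lra.
have h1 : 0 <= a * - sin ((m%:R + 1) * delta).
  rewrite mulr_ge0// oppr_ge0 sin_le0_pi//; apply/andP; split; lra.
have h2 : 0 <= b * - sin ((m%:R + 2) * delta).
  rewrite mulr_ge0// oppr_ge0 sin_le0_pi//; apply/andP; split; lra.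
by apply/orP; right; lra.
Qed.

Lemma sect_exists z : exists k a b,
  [/\ (k < d)%N, 0 <= a, 0 <= b & z = sect d k a b].
Proof.
have [r [t [r0 /andP[t0 t2] ->]]] := polar z.
have s0 := sin_central_angle_gt0; have de0 := central_angle_gt0 d0.
have dd := mulr_central_angle d0; have pi0 := pi_gt0 R.
have dle := central_angle_le.
have td0 : 0 <= t / delta by rewrite divr_ge0// ltW.
set k := Num.truncn (t / delta).
have /andP[k1 k2] := truncn_itv td0; rewrite -/k in k1 k2.
rewrite ler_pdivlMr// in k1; rewrite ltr_pdivrMr// -natr1 in k2.
set u := t - k%:R * delta.
have u0 : 0 <= u by rewrite /u; lra.
have u1 : u < delta by rewrite /u; lra.
(* Law of sines in a sector of angle [delta], with [u] the angle past corner [k]. *)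
exists k, (r * (sin (delta - u) / sin delta)), (r * (sin u / sin delta)); split.
- by rewrite /k truncn_lt_nat// ltr_pdivrMr// dd.
- rewrite mulr_ge0// divr_ge0 ?(ltW s0)// sin_ge0_pi//.
  by apply/andP; split; lra.
- rewrite mulr_ge0// divr_ge0 ?(ltW s0)// sin_ge0_pi//.
  by apply/andP; split; lra.
have -> : t = k%:R * delta + u by rewrite /u; ring.
rewrite /sect !cornerE/= -natr1 mulrDl mul1r !(cosD, sinD, cosN, sinN).
have := cos2Dsin2 delta; set c := cos delta; set s := sin delta => cs.
by congr pair; field : cs; rewrite gt_eqF.
Qed.

End GoodSize.
End Hats.

(** * The regular polygon as the unit ball of its gauge *)

Section Gauge.
Variables (R : realType) (d : nat).
Hypothesis d4 : (4 <= d)%N.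
Let d0 : (0 < d)%N. Proof. exact: leq_trans d4. Qed.
Implicit Types (i k : nat) (a b : R) (z w : R * R).
Local Notation delta := (central_angle R d).
Local Notation s := (@gauge R d).

Lemma hat_sectE i k a b : (i < d)%N -> (k < d)%N -> 0 <= a -> 0 <= b ->
  hat d i (sect d k a b) = a * (i == k)%:R + b * (i == k.+1 %% d :> nat)%N%:R.
Proof.
move=> id kd a0 b0; have kE : (k.+1 %% d = if k.+1 == d then 0 else k.+1)%N.
  by case: eqP => [->|kd1]; [rewrite modnn|rewrite modn_small//; lia].
rewrite kE; case: (k.+1 =P d) => kd1; have [ik|ki] := leqP i k.
- rewrite -{1}(subnKC ik) hat_sect//; last by lia.
  by do 4 try case: eqP => //=; move=> *; try lia; ring.
- by lia.
- rewrite -{1}(subnKC ik) hat_sect//; last by lia.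
  by do 4 try case: eqP => //=; move=> *; try lia; ring.
(* Here [k < i]: renumbering the sector as [k + d] makes it [i + m] with [m = k + d - i]. *)
rewrite -(sect_mod k a b d0) -[k in (k %% d)%N](addn0 k) -(modnn d) modnDmr sect_mod//.
have -> : (k + d = i + (k + d - i))%N by lia.
rewrite hat_sect//; last by lia.
by do 4 try case: eqP => //=; move=> *; try lia; ring.
Qed.

Lemma sum_indicator (c : R) (F : nat -> R) k : (k < d)%N ->
  \sum_(i < d) c * ((i : nat) == k)%:R * F i = c * F k.
Proof.
move=> kd; rewrite (bigD1 (Ordinal kd))//= eqxx mulr1 big1 ?addr0// => i ik.
by rewrite (_ : (i : nat) == k = false) ?mulr0 ?mul0r//; apply/negbTE.
Qed.

Lemma sum_hat (F : nat -> R) k a b : (k < d)%N -> 0 <= a -> 0 <= b ->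
  \sum_(i < d) hat d i (sect d k a b) * F i = a * F k + b * F (k.+1 %% d)%N.
Proof.
move=> kd a0 b0; rewrite -[in RHS]sum_indicator// -[in RHS](sum_indicator b)//; last first.
  by rewrite ltn_mod.
by rewrite -big_split/=; apply: eq_bigr => i _; rewrite hat_sectE// mulrDl.
Qed.

(** Two consecutive hats are both positive only inside the sector between their corners. This yields
    the coordinates of the edges opposite the centre of a star. *)
Lemma sum_hat2 (F : nat -> R) k a b : (k < d)%N -> 0 <= a -> 0 <= b ->
  \sum_(i < d) hat d i (sect d k a b) * hat d (i.+1 %% d) (sect d k a b) * F i =
  a * b * F k.
Proof.
move=> kd a0 b0.
have kE m : (m < d)%N -> (m.+1 %% d = if m.+1 == d then 0 else m.+1)%N.
  by move=> md; case: eqVneq => [->|kd1]; [rewrite modnn|rewrite modn_small//; lia].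
rewrite (bigD1 (Ordinal kd))//= big1 => [|i /eqP/eqP ik].
  rewrite addr0 !hat_sectE ?ltn_mod// !eqxx kE//.
  case: (k.+1 =P d) => kd1; do 4 try case: eqP => //=; by move=> *; try lia; ring.
have {}ik : (i : nat) != k by [].
rewrite !hat_sectE ?ltn_mod// !kE//.
have il := ltn_ord i; case: (k.+1 =P d) => kd1; case: (i.+1 =P d) => id1;
  by do 4 try (case: eqP => ? /=); try lia; ring.
Qed.

Lemma gauge_sect k a b : (k < d)%N -> 0 <= a -> 0 <= b ->
  s (sect d k a b) = a + b.
Proof.
move=> kd a0 b0; rewrite /gauge; under eq_bigr do rewrite -[hat _ _ _]mulr1.
by rewrite (sum_hat (fun=> 1))// !mulr1.
Qed.

Lemma hat_expand z : z = (\sum_(i < d) hat d i z * (corner R d i).1,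
                          \sum_(i < d) hat d i z * (corner R d i).2).
Proof.
have [k [a [b [kd a0 b0 ->]]]] := sect_exists d4 z.
rewrite (sum_hat (fun i => (corner R d i).1))// (sum_hat (fun i => (corner R d i).2))//.
by rewrite !corner_mod.
Qed.

Lemma hat_ge0 i z : 0 <= hat d i z.
Proof. by rewrite /hat divr_ge0 ?le_max ?lexx// ltW// sin_central_angle_gt0. Qed.

Lemma gauge_ge0 z : 0 <= s z.
Proof. by rewrite sumr_ge0// => i _; exact: hat_ge0. Qed.

Lemma gaugeZ t z : 0 <= t -> s (t * z.1, t * z.2) = t * s z.
Proof.
move=> t0; have [k [a [b [kd a0 b0 ->]]]] := sect_exists d4 z.
rewrite gauge_sect// (_ : (_, _) = sect d k (t * a) (t * b)).
  by rewrite gauge_sect ?mulr_ge0// mulrDr.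
by rewrite /sect/=; congr pair; ring.
Qed.

Lemma gauge0 : s (0, 0) = 0.
Proof. by have := gaugeZ (0, 0) (lexx 0); rewrite !mul0r. Qed.

Lemma gauge_eq0 z : s z = 0 -> z = (0, 0).
Proof.
move=> /eqP; rewrite psumr_eq0 => [/allP h|i _]; last exact: hat_ge0.
have h0 (i : 'I_d) : hat d i z = 0 by apply/eqP/h; rewrite mem_index_enum.
by rewrite (hat_expand z) !big1 => // i _; rewrite h0 mul0r.
Qed.

Lemma norm_le_gauge z : `|z.1| <= s z /\ `|z.2| <= s z.
Proof.
rewrite [in X in `|X.1|](hat_expand z) [in X in `|X.2|](hat_expand z)/=.
split; apply: le_trans (ler_norm_sum _ _ _) _; apply: ler_sum => i _;
  rewrite normrM (ger0_norm (hat_ge0 _ _)); apply: ler_piMr;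
  by rewrite ?hat_ge0 ?cos_max ?sin_max.
Qed.

Lemma compact_gauge : compact [set z | s z <= 1].
Proof.
have box : compact (`[-1, 1] `*` `[-1, 1] : set (R * R)).
  by apply: compact_setX; exact: segment_compact.
apply: (subclosed_compact _ box).
  by apply: closed_real_le; exact: continuous_gauge.
move=> z /= sz; have [h1 h2] := norm_le_gauge z.
by split; rewrite /= in_itv/= -ler_norml; [apply: le_trans h1 _|apply: le_trans h2 _].
Qed.

Lemma open_gauge : open [set z | s z < 1].
Proof. by apply: open_real_lt; exact: continuous_gauge. Qed.

Lemma continuous_scale z : continuous (fun t : R => (t * z.1, t * z.2)).
Proof. by apply: continuous_pair; prove_continuous. Qed.

Lemma connected_star_shaped (A : set (R * R)) :
  (forall z t, A z -> 0 <= t <= 1 -> A (t * z.1, t * z.2)) -> connected A.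
Proof.
move=> starA.
have -> : A = \bigcup_(z in A) ((fun t : R => (t * z.1, t * z.2)) @` `[0, 1]).
  apply/seteqP; split => z /=.
    move=> Az; exists z => //; exists 1; last by rewrite !mul1r -surjective_pairing.
    by rewrite /= in_itv/= ler01 lexx.
  by move=> [w /= Aw [t /=]]; rewrite in_itv/= => t01 <-; exact: starA.
apply: bigcup_connected => [|w Aw].
  by exists (0, 0) => w Aw; exists 0; rewrite ?mul0r//= in_itv/= lexx ler01.
apply: connected_continuous_connected; first exact: segment_connected.
by apply: continuous_subspaceT; exact: continuous_scale.
Qed.

Lemma gauge_scale_le z t : 0 <= t <= 1 -> s (t * z.1, t * z.2) <= s z.
Proof. by move=> /andP[t0 t1]; rewrite gaugeZ// ler_piMl// gauge_ge0. Qed.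

Lemma connected_gauge : connected [set z | s z < 1].
Proof.
by apply: connected_star_shaped => z t /= sz t01; apply: le_lt_trans sz; exact: gauge_scale_le.
Qed.

Lemma connected_gauge_le : connected [set z | s z <= 1].
Proof.
by apply: connected_star_shaped => z t /= sz t01; apply: le_trans sz; exact: gauge_scale_le.
Qed.

Lemma interior_gauge : interior [set z | s z <= 1] = [set z | s z < 1].
Proof.
apply/seteqP; split => [z|].
  move=> zi; have szle : s z <= 1 by exact: (interior_subset zi).
  rewrite /= lt_def szle andbT; apply/eqP => sz1.
  have : nbhs ((1 : R) * z.1, 1 * z.2) [set w | s w <= 1].
    by rewrite !mul1r -surjective_pairing.
  (* A slight dilation pushes a boundary point out of the polygon. *)
  move=> /(continuous_scale)/nbhs_ballP[e /= e0 he].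
  have := he (1 + e / 2); rewrite /ball/= opprD addrA subrr sub0r normrN.
  rewrite gtr0_norm ?divr_gt0// ltr_pdivrMr// ltr_pMr// ltr1n => /(_ isT).
  by rewrite gaugeZ; [rewrite -sz1; lra|lra].
move=> z sz; apply: (@filterS _ _ _ [set z | s z < 1]); first by move=> w /= /ltW.
by apply: open_nbhs_nbhs; split => //; exact: open_gauge.
Qed.

Let enorm z : R := Num.sqrt (z.1 ^+ 2 + z.2 ^+ 2).

(** The radial map [z / (1 - s z + |z|)] carries the gauge ball to the disc, and its inverse is the
    same formula with gauge and norm exchanged. The origin needs no separate treatment, and the
    [max] in [q] keeps the denominator positive on the whole plane. *)
Lemma homeomorphic_gauge_disc :
  @homeomorphic _ _ [set z | s z < 1] (@open_disc R).
Proof.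
have n_cont : real_continuous enorm by rewrite /enorm; prove_continuous.
have n0 z : 0 <= enorm z by exact: sqrtr_ge0.
have nZ t z : 0 <= t -> enorm (t * z.1, t * z.2) = t * enorm z.
  move=> t0; rewrite /enorm/= !exprMn -mulrDr sqrtrM ?sqr_ge0//.
  by rewrite sqrtr_sqr ger0_norm.
have n_eq0 z : enorm z = 0 -> z = (0, 0).
  move=> /eqP; rewrite sqrtr_eq0 => h; case: z h => x y /= h.
  have x0 := sqr_ge0 x; have y0 := sqr_ge0 y.
  have /eqP : x ^+ 2 = 0 by lra.
  have /eqP : y ^+ 2 = 0 by lra.
  by rewrite !sqrf_eq0 => /eqP -> /eqP ->.
have disc z : open_disc z <-> enorm z < 1.
  rewrite /open_disc/enorm /= -{2}(sqrtr1 R) ltr_sqrt//.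
pose q (u v : R * R -> R) z := Num.max 0 (1 - u z) + v z.
have key (u v : R * R -> R) : (forall z, 0 <= u z) -> (forall z, 0 <= v z) ->
    u (0, 0) = 0 -> (forall z, v z = 0 -> z = (0, 0)) ->
    forall z, 0 < q u v z.
  move=> u0 v0 u00 v_eq0 z; rewrite /q.
  have [/v_eq0 ->|vn] := eqVneq (v z) 0.
    by rewrite u00 subr0 ltr_pwDl// (max_idPr _).
  by rewrite ltr_wpDl ?le_max ?lexx// lt_def vn v0.
have n00 : enorm (0, 0) = 0 by rewrite /enorm/= expr0n addr0 sqrtr0.
have q1 := key s enorm gauge_ge0 n0 gauge0 n_eq0.
have q2 := key enorm s n0 gauge_ge0 n00 gauge_eq0.
pose f u v z : R * R := ((q u v z)^-1 * z.1, (q u v z)^-1 * z.2).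
have fc (u v : R * R -> R) : real_continuous u -> real_continuous v -> (forall z, 0 < q u v z) ->
    continuous (f u v).
  move=> cu cv q0; apply: continuous_pair; apply: real_continuousM; rewrite /q;
    try exact: real_continuous_fst; try exact: real_continuous_snd;
    apply: real_continuousV => [z|]; try (by rewrite gt_eqF// q0);
    apply: real_continuousD => //; apply: real_continuous_max;
    try exact: real_continuous_cst; apply: real_continuousD;
    try exact: real_continuous_cst; exact: real_continuousN.
have fK (u v : R * R -> R) z :
    (forall t z, 0 <= t -> u (t * z.1, t * z.2) = t * u z) ->
    (forall t z, 0 <= t -> v (t * z.1, t * z.2) = t * v z) ->
    0 <= u z -> 0 <= v z -> u z < 1 -> 0 < q u v z ->
    v (f u v z) < 1 /\ f v u (f u v z) = z.
  move=> uZ vZ u0 v0 u1 q0.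
  have qE : q u v z = 1 - u z + v z by rewrite /q (max_idPr _)//; lra.
  have qi0 : 0 <= (q u v z)^-1 by rewrite invr_ge0 ltW.
  have vf : v (f u v z) = (q u v z)^-1 * v z by rewrite vZ.
  have uf : u (f u v z) = (q u v z)^-1 * u z by rewrite uZ.
  have v1 : v (f u v z) < 1.
    by rewrite vf mulrC ltr_pdivrMr// qE; lra.
  split => //.
  have qn : q u v z != 0 by rewrite gt_eqF.
  have -> : f v u (f u v z) = (q u v z * (f u v z).1, q u v z * (f u v z).2).
    rewrite {1}/f /q vf uf (max_idPr _); last by rewrite -vf; lra.
    rewrite -/(q u v z).
    have -> : 1 - (q u v z)^-1 * v z + (q u v z)^-1 * u z = (q u v z)^-1.
      by apply: (mulfI qn); rewrite mulrDr mulrBr !mulrA divff// !mul1r mulr1 qE; ring.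
    by rewrite invrK.
  by rewrite /f/= !mulrA divff// !mul1r -surjective_pairing.
exists (f s enorm), (f enorm s); split.
- by move=> z /= sz; apply/disc; apply: (fK s enorm z gaugeZ nZ _ _ sz (q1 z)).1;
    [exact: gauge_ge0|exact: n0].
- by move=> z /disc sz; apply: (fK enorm s z nZ gaugeZ _ _ sz (q2 z)).1;
    [exact: n0|exact: gauge_ge0].
- by move=> z /= sz; apply: (fK s enorm z gaugeZ nZ _ _ sz (q1 z)).2;
    [exact: gauge_ge0|exact: n0].
- by move=> z /disc sz; apply: (fK enorm s z nZ gaugeZ _ _ sz (q2 z)).2;
    [exact: n0|exact: gauge_ge0].
- by split; apply: continuous_subspaceT; apply: fc => //; exact: continuous_gauge.
Qed.

End Gauge.

(** * The convex hull of the corners *)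

Section Polygon.
Variables (R : realType) (d : nat).
Hypothesis d4 : (4 <= d)%N.
Let d0 : (0 < d)%N. Proof. exact: leq_trans d4. Qed.
Local Notation delta := (central_angle R d).

(* All corners lie on the same side of the line through two consecutive ones. *)
Lemma corner_le_side m : (m < d)%N ->
  sin (m%:R * delta) - sin ((m%:R - 1) * delta) <= sin delta.
Proof.
move=> md; have de0 := central_angle_gt0 R d0.
set h := delta / 2; have dE : delta = h + h by rewrite /h; field.
have h0 : 0 <= h by rewrite /h; lra.
have mh : m%:R * h <= pi.
  by have := natr_central_angle R d4 (ltnW md); rewrite /h; lra.
have s1 : 0 <= sin h.
  have := central_angle_le R d4; rewrite /h => h2.
  by apply: sin_ge0_pi; apply/andP; split; lra.
(* With half angles the defect factors, and all factors are nonnegative once [m >= 1], since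
   [m * h <= pi]. *)
have key : sin delta - (sin (m%:R * delta) - sin ((m%:R - 1) * delta)) =
    4 * sin h * (sin (m%:R * h) * sin ((m%:R - 1) * h)).
  have -> : m%:R * h = (m%:R - 1) * h + h by ring.
  have -> : m%:R * delta = ((m%:R - 1) * h + (m%:R - 1) * h) + (h + h).
    by rewrite dE; ring.
  have -> : (m%:R - 1) * delta = (m%:R - 1) * h + (m%:R - 1) * h.
    by rewrite dE; ring.
  rewrite dE; set A := (m%:R - 1) * h; rewrite !(sinD, cosD).
  have cA := cos2sin2 A; have ch := cos2sin2 h.
  by ring: cA ch.
rewrite -subr_ge0 key mulr_ge0//; first by rewrite mulr_ge0.
case: m md mh key => [|m] md mh _; first by rewrite mul0r sin0 mul0r.
have mR : 0 <= m%:R * h by rewrite mulr_ge0.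
by rewrite -natr1 addrK in mh *; rewrite mulr_ge0// sin_ge0_pi//; apply/andP; split; lra.
Qed.

Lemma polygonE : ~~ odd d -> polygon d = [set z | @gauge R d z <= 1].
Proof.
move=> d_even; have s0 := sin_central_angle_gt0 R d4.
apply/seteqP; split => [z [a [a0 a1 z1 z2]]|z /= sz].
  have [k [b [c [kd b0 c0 zE]]]] := sect_exists d4 z.
  rewrite /= {1}zE gauge_sect//.
  (* The linear form equal to 1 on side [k]: it agrees with the gauge on the sector of [z] and is at
     most 1 at every corner. *)
  pose l w := (det w (corner R d k.+1) + det (corner R d k) w) / sin delta.
  have lz : l z = b + c.
    rewrite /l zE /sect detZDl detZDr !det_corner !subrr mul0r sin0 !mulr0.
    rewrite add0r addr0 -natr1 addrAC subrr add0r mul1r -mulrDl mulfK//.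
    by rewrite gt_eqF.
  have -> : b + c = \sum_i a i * l (corner R d i).
    rewrite -lz /l /det z1 z2 !mulr_suml !mulr_sumr -!sumrB.
    by rewrite -big_split/= mulr_suml; apply: eq_bigr => i _; ring.
  rewrite -a1; apply: ler_sum => i _; rewrite ler_piMr// /l ler_pdivrMr// mul1r.
  have [ki|ik] := leqP k i.
    have md : (i - k < d)%N by have := ltn_ord i; lia.
    have := corner_le_side md; rewrite !det_corner natrB//.
    have -> : (k.+1%:R - i%:R) * delta = - ((i%:R - k%:R - 1) * delta).
      by rewrite -natr1; ring.
    by rewrite sinN addrC.
  have md : (i + d - k < d)%N by lia.
  have := corner_le_side md; rewrite -(corner_periodic R i d0) !det_corner.
  rewrite natrB; last by lia.
  have -> : (k.+1%:R - (i + d)%:R) * delta = - (((i + d)%:R - k%:R - 1) * delta).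
    by rewrite -natr1; ring.
  by rewrite sinN addrC.
have hd : (d./2 < d)%N by lia.
(* The hats of [z] have sum [gauge d z]. The missing weight is shared equally by the corners [0] and
   [d./2], which are opposite as [d] is even and so cancel. *)
pose g := (1 - gauge d z) / 2.
exists (fun i : 'I_d => hat d i z + g * ((i : nat) == 0%N)%:R * 1 +
                        g * ((i : nat) == d./2)%:R * 1).
have opp : (corner R d d./2).1 = - (corner R d 0).1 /\
           (corner R d d./2).2 = - (corner R d 0).2.
  have -> : corner R d d./2 = (cos (0 + pi), sin (0 + pi)).
    rewrite cornerE (_ : d./2%:R * delta = 0 + pi)// add0r.
    have := mulr_central_angle R d0; rewrite -{1}(even_halfK d_even) -muln2 natrM; lra.
  by rewrite cosDpi sinDpi cornerE !mul0r.
have sumE (F : nat -> R) : \sum_(i < d) (hat d i z +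
     g * ((i : nat) == 0%N)%:R * 1 + g * ((i : nat) == d./2)%:R * 1) * F i =
     \sum_(i < d) hat d i z * F i + g * F 0%N + g * F d./2.
  rewrite -(sum_indicator g F d0) -(sum_indicator g F hd) -!big_split/=.
  by apply: eq_bigr => i _; rewrite !mulr1; ring.
split.
- by move=> k; rewrite !addr_ge0 ?hat_ge0// !mulr1 mulr_ge0// /g; lra.
- rewrite !big_split/= (sum_indicator g (fun=> 1) d0) (sum_indicator g (fun=> 1) hd).
  by rewrite -/(gauge d z) /g; lra.
- by rewrite (sumE (fun i => (corner R d i).1)) opp.1 {1}(hat_expand d4 z)/=; ring.
- by rewrite (sumE (fun i => (corner R d i).2)) opp.2 {1}(hat_expand d4 z)/=; ring.
Qed.

End Polygon.

(** * Winding numbers *)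

Section Winding.
Variable R : realType.
Implicit Types (gamma : R -> R * R) (t r : R).

(* The angle from [e^{i(t + phi)}] to [gamma t] never reaches [pi], so that its
   principal determination [2 atan (y / (|q| + x))] is continuous. *)
Lemma winding_number_one gamma (phi : R) :
  real_continuous (fun t => (gamma t).1) ->
  real_continuous (fun t => (gamma t).2) ->
  gamma (2 * pi) = gamma 0 ->
  (forall t c, 0 <= c -> gamma t <> (- c * cos (t + phi), - c * sin (t + phi))) ->
  winding_number gamma 1.
Proof.
move=> c1 c2 per opp.
pose q1 t := (gamma t).1 * cos (t + phi) + (gamma t).2 * sin (t + phi).
pose q2 t := (gamma t).2 * cos (t + phi) - (gamma t).1 * sin (t + phi).
pose n t := Num.sqrt (q1 t ^+ 2 + q2 t ^+ 2).
have cq1 : real_continuous q1 by rewrite /q1; prove_continuous.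
have cq2 : real_continuous q2 by rewrite /q2; prove_continuous.
have cn : real_continuous n by rewrite /n; prove_continuous.
have n0 t : 0 <= n t by exact: sqrtr_ge0.
have n2 t : n t ^+ 2 = q1 t ^+ 2 + q2 t ^+ 2 by rewrite sqr_sqrtr// addr_ge0 ?sqr_ge0.
have gE t : gamma t = (q1 t * cos (t + phi) - q2 t * sin (t + phi),
                       q1 t * sin (t + phi) + q2 t * cos (t + phi)).
  have cs := cos2sin2 (t + phi); rewrite /q1 /q2 [LHS]surjective_pairing.
  by congr pair; ring: cs.
have pos t : 0 < n t + q1 t.
  have [//|le0] := ltP; exfalso.
  have q20 : q2 t = 0.
    have h := sqr_ge0 (q2 t).
    have : n t ^+ 2 <= q1 t ^+ 2 by rewrite -(sqrrN (q1 t)) ler_pXn2r// ?nnegrE//; have := n0 t; lra.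
    by rewrite n2 => ?; apply/eqP; rewrite -sqrf_eq0; apply/eqP; lra.
  have q1n : 0 <= - q1 t by have := n0 t; lra.
  by apply: (opp t _ q1n); rewrite gE q20 !opprK; congr pair; ring.
have npos t : 0 < n t.
  rewrite lt_def n0 andbT; apply/eqP => nt; have := n2 t; have := pos t.
  rewrite nt expr0n/= add0r => ? ?; have := sqr_ge0 (q2 t).
  have : 0 < q1 t ^+ 2 by rewrite exprn_gt0. lra.
pose u t := q2 t / (n t + q1 t).
have cu : real_continuous u.
  apply: real_continuousM => //; apply: real_continuousV => [t|]; first by rewrite gt_eqF.
  exact: real_continuousD.
exists n, (fun t => t + phi + 2 * atan (u t)); split.
- apply: continuous_subspaceT.
  have ct : real_continuous (fun t => t + phi + 2 * atan (u t)) by prove_continuous.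
  exact: ct.
- by move=> t _; exact: npos.
- move=> t _; have un : n t + q1 t != 0 by rewrite gt_eqF.
  have nn : n t != 0 by rewrite gt_eqF.
  have C2 : cos (atan (u t)) ^+ 2 = (n t + q1 t) / (2 * n t).
    rewrite cos_atan exprVn sqr_sqrtr ?addr_ge0 ?sqr_ge0//.
    have -> : 1 + u t ^+ 2 = (2 * n t) / (n t + q1 t).
      by rewrite /u; field : (n2 t).
    by rewrite invf_div.
  have c0 : cos (atan (u t)) != 0.
    by rewrite cos_atan invr_eq0 gt_eqF// sqrtr_gt0 ltr_pwDl// sqr_ge0.
  have S : sin (atan (u t)) = u t * cos (atan (u t)).
    by rewrite -{2}(atanK (u t)) /tan divfK.
  have c2E : cos (2 * atan (u t)) = q1 t / n t.
    by rewrite mulr_natl cos_mulr2n C2; field.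
  have s2E : sin (2 * atan (u t)) = q2 t / n t.
    by rewrite mulr_natl sin_mulr2n S mulrCA -expr2 C2 /u; field; rewrite nn.
  rewrite gE /= (cosD (t + phi)) (sinD (t + phi)) c2E s2E; congr pair; field; exact: nn.
- have q1p : q1 (2 * pi) = q1 0.
    by rewrite /q1 per (addrC (2 * pi)) mulr_natl cosD2pi sinD2pi add0r.
  have q2p : q2 (2 * pi) = q2 0.
    by rewrite /q2 per (addrC (2 * pi)) mulr_natl cosD2pi sinD2pi add0r.
  rewrite /u /n q1p q2p; ring.
Qed.

(* In the frames rotated by [eta] and [phi], [h] is the shear
   [(a, b) |-> (a + kappa |b|, mu b)], folded along the axis [b = 0]. *)
Lemma orientation_preserving_fold (h : R * R -> R * R) (p K : R * R)
    (kappa mu eta phi : R) : 0 < mu ->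
  (\forall z \near p,
     let a := z.1 * cos eta + z.2 * sin eta in
     let b := z.2 * cos eta - z.1 * sin eta in
     h z = (K.1 + ((a + kappa * `|b|) * cos phi - mu * b * sin phi),
            K.2 + ((a + kappa * `|b|) * sin phi + mu * b * cos phi))) ->
  orientation_preserving_at h p.
Proof.
move=> mu0 /nbhs_ballP[e /= e0 he].
pose f (z : R * R) : R * R :=
  let a := z.1 * cos eta + z.2 * sin eta in
  let b := z.2 * cos eta - z.1 * sin eta in
  (K.1 + ((a + kappa * `|b|) * cos phi - mu * b * sin phi),
   K.2 + ((a + kappa * `|b|) * sin phi + mu * b * cos phi)).
have hf r t : 0 < r -> r < e ->
    h (p + (r * cos t, r * sin t)) = f (p + (r * cos t, r * sin t)).
  move=> r0 re; apply: he; split; rewrite /ball/= opprD addrA subrr sub0r normrN;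
    rewrite normrM gtr0_norm//; apply: le_lt_trans re; rewrite ler_piMr ?(ltW r0)//.
    exact: cos_max.
  exact: sin_max.
have hp : h p = f p by apply: he; exact: ballxx.
near=> r.
have r0 : 0 < r by near: r; exact: nbhs_right_gt.
have re : r < e by near: r; exact: nbhs_right_lt.
have -> : (fun t => h (p + (r * cos t, r * sin t)) - h p) =
          (fun t => f (p + (r * cos t, r * sin t)) - f p).
  by apply/funext => t; rewrite hf// hp.
(* A displacement in direction [t] is compared with direction [t + phi - eta]. If its image pointed
   the opposite way, the second coordinate would give [y = 0] as [mu > 0]; the two absolute values
   in [A] then cancel, and [x = 0] as well. *)
apply: (@winding_number_one _ (phi - eta)).
- by rewrite /f /=; prove_continuous.
- by rewrite /f /=; prove_continuous.
- by rewrite [2 * pi]mulr_natl -[pi *+ 2]add0r cosD2pi sinD2pi.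
move=> t c c0 [E1 E2].
pose b0 := p.2 * cos eta - p.1 * sin eta.
pose x := cos (t - eta); pose y := sin (t - eta).
have xE : x = cos t * cos eta + sin t * sin eta by rewrite /x cosB.
have yE : y = sin t * cos eta - cos t * sin eta by rewrite /y sinB.
pose A := r * x + kappa * (`|b0 + r * y| - `|b0|).
have bE : (p.2 + r * sin t) * cos eta - (p.1 + r * cos t) * sin eta = b0 + r * y.
  by rewrite yE /b0; ring.
have tE : t + (phi - eta) = (t - eta) + phi by ring.
have cs := cos2sin2 phi.
have {}E1 : A * cos phi - mu * (r * y) * sin phi =
            - c * (x * cos phi - y * sin phi).
  rewrite -cosD -tE -E1 bE -/b0 /A xE; rewrite /b0 yE; ring.
have {}E2 : A * sin phi + mu * (r * y) * cos phi =
            - c * (x * sin phi + y * cos phi).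
  rewrite [x * _ + _]addrC -sinD -tE -E2 bE -/b0 /A xE; rewrite /b0 yE; ring.
have EA : A = - c * x.
  transitivity (A * (cos phi ^+ 2 + sin phi ^+ 2)); first by rewrite cos2Dsin2 mulr1.
  transitivity ((A * cos phi - mu * (r * y) * sin phi) * cos phi +
                (A * sin phi + mu * (r * y) * cos phi) * sin phi); first by ring.
  by rewrite E1 E2; ring: cs.
have EB : mu * (r * y) = - c * y.
  transitivity (mu * (r * y) * (cos phi ^+ 2 + sin phi ^+ 2)).
    by rewrite cos2Dsin2 mulr1.
  transitivity ((A * sin phi + mu * (r * y) * cos phi) * cos phi -
                (A * cos phi - mu * (r * y) * sin phi) * sin phi); first by ring.
  by rewrite E1 E2; ring: cs.
have y0 : y = 0.
  have /eqP : (mu * r + c) * y = 0 by rewrite mulrDl -mulrA EB; ring.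
  by rewrite mulf_eq0 gt_eqF/= => [/eqP//|]; rewrite ltr_pwDl// mulr_gt0.
have x0 : x = 0.
  move: EA; rewrite /A y0 mulr0 addr0 subrr mulr0 addr0 => EA.
  have /eqP : (r + c) * x = 0 by rewrite mulrDl EA; ring.
  by rewrite mulf_eq0 gt_eqF/= => [/eqP//|]; rewrite ltr_pwDl.
have := cos2Dsin2 (t - eta); rewrite -/x -/y x0 y0 expr0n/= addr0.
by move/eqP; rewrite eq_sym oner_eq0.
Unshelve. all: by end_near.
Qed.

End Winding.

(** * Triangulated surfaces *)

Lemma continuous_ptws (R : realType) (T : topologicalType) (I : eqType)
    (f : T -> {ptws I -> R}) :
  (forall i, real_continuous (fun x => f x i)) -> continuous f.
Proof.
move=> cf x; apply/cvg_sup => i U [V [[W oW <-] Wfx WU]].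
by apply: (filterS WU); apply: (cf i x); apply: open_nbhs_nbhs.
Qed.

Lemma real_continuous_proj (R : realType) (I : eqType) (i : I) :
  real_continuous (fun x : {ptws I -> R} => x i).
Proof. exact: (@proj_continuous I (fun=> R) i). Qed.

Section SetType.
Variables (X : topologicalType) (A : set X).

Lemma continuous_set_val : continuous (\val : set_type A -> X).
Proof. exact: initial_continuous. Qed.

Lemma within_continuous_insubd (T : topologicalType) (D : set T) (f : T -> X)
    (x0 : set_type A) :
  (forall z, D z -> A (f z)) -> {within D, continuous f} ->
  {within D, continuous (fun z => insubd x0 (f z) : set_type A)}.
Proof.
move=> fA /subspace_sigL_continuousP cf; apply/subspace_sigL_continuousP.
apply: (@continuous_comp_initial _ _ _ (\val : set_type A -> X)).
rewrite (_ : _ \o _ = sigL D f)//; apply/funext => z /=.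
by rewrite /sigL/= insubdK//; apply/mem_set/fA; exact: set_valP.
Qed.

Lemma hausdorff_set_type : hausdorff_space X -> hausdorff_space (set_type A).
Proof.
move=> hX x y xy; apply/val_inj/hX => U V Ux Vy.
have /(_ (\val @^-1` U) (\val @^-1` V)) := xy.
by case=> [||z [Uz Vz]]; [exact: continuous_set_val..|exists (\val z)].
Qed.

End SetType.

(* A closed oriented surface glued from triangles, presented by their corners:
   [nextc a] is the next corner of the triangle of [a], and [opp a] is the corner
   from which the edge [a -> nextc a] is traversed backwards in the neighbouring
   triangle. Then [opp (nextc (nextc a))] is the corner following [a] around
   [vert a], and the corners at a given vertex form a single cycle. *)
Record triangulation (C W : finType) := Triangulation {
  vert : C -> W;
  nextc : C -> C;
  opp : C -> C;
  base : W -> C;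
  rot_around := fun a => opp (nextc (nextc a));
  deg := fun w => order rot_around (base w);
  nextc3 : forall a, nextc (nextc (nextc a)) = a;
  oppK : involutive opp;
  vert_opp : forall a, vert (opp a) = vert (nextc a);
  vert_nextc : forall a, vert (nextc a) != vert a;
  vert_base : forall w, vert (base w) = w;
  fconnect_base : forall a, fconnect rot_around (base (vert a)) a;
  deg_ge4 : forall w, (4 <= deg w)%N }.

Section Triangulation.
Variables (R : realType) (C W : finType) (K : triangulation C W).
Implicit Types (a b : C) (w : W) (t : R) (z : R * R).
Local Notation nextc := (nextc K).
Local Notation opp := (opp K).
Local Notation vert := (vert K).
Local Notation rot_around := (rot_around K).
Local Notation deg := (deg K).
Local Notation space := {ptws (W + C)%type -> R}.

Definition around w i := iter i rot_around (base K w).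

(** A corner [a] stands for the edge from [a] to [nextc a]; forgetting directions, an edge is an
    orbit of [opp]. *)
Definition side a b := (b == a) || (b == opp a).

(* The point with barycentric coordinates [t0, t1, t2] in the triangle of [a]:
   its weight at each vertex, and the product of its weights at the two ends of
   each edge. Two edges may join the same vertices; the products tell them apart. *)
Definition point_of a t0 t1 t2 : space := fun i =>
  match i with
  | inl w => t0 * (w == vert a)%:R + t1 * (w == vert (nextc a))%:R +
             t2 * (w == vert (nextc (nextc a)))%:R
  | inr b => t0 * t1 * (side a b)%:R + t1 * t2 * (side (nextc a) b)%:R +
             t2 * t0 * (side (nextc (nextc a)) b)%:R
  end.

Definition simplex t0 t1 t2 := [/\ 0 <= t0, 0 <= t1, 0 <= t2 & t0 + t1 + t2 = 1].

Definition body : set space :=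
  [set x | exists a t0 t1 t2, simplex t0 t1 t2 /\ x = point_of a t0 t1 t2].

Definition glued := set_type body.

Lemma point_of_nextc a t0 t1 t2 : point_of (nextc a) t1 t2 t0 = point_of a t0 t1 t2.
Proof.
by apply/funext => -[w|b] /=; rewrite nextc3 addrC addrA.
Qed.

Lemma nextc_inj : injective nextc.
Proof. by move=> a b ab; rewrite -(nextc3 K a) -(nextc3 K b) ab. Qed.

Lemma rot_around_inj : injective rot_around.
Proof. by move=> a b /(can_inj (oppK K))/nextc_inj/nextc_inj. Qed.

Lemma vert_nextc_opp a : vert (nextc (opp a)) = vert a.
Proof. by rewrite -vert_opp oppK. Qed.

Lemma vert_around w i : vert (around w i) = w.
Proof.
elim: i => [|i IH]; first exact: vert_base.
by rewrite -[RHS]IH /around/= vert_opp nextc3.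
Qed.

Lemma vert_nextc2 a : vert (nextc (nextc a)) != vert a.
Proof. by rewrite -[in X in _ != X](nextc3 K a) eq_sym vert_nextc. Qed.

Lemma deg_gt0 w : (0 < deg w)%N.
Proof. exact: leq_trans (deg_ge4 K w). Qed.

Lemma around_deg w i : around w (i + deg w) = around w i.
Proof. by rewrite /around iterD; congr iter; exact: iter_order rot_around_inj _. Qed.

Lemma around_mod w i : around w (i %% deg w) = around w i.
Proof.
rewrite {2}(divn_eq i (deg w)) addnC; elim: (_ %/ _)%N => [|q IH].
  by rewrite mul0n addn0.
by rewrite IH mulSn (addnC (deg w)) addnA around_deg.
Qed.

Lemma around_surj a : exists2 i, (i < deg (vert a))%N & around (vert a) i = a.
Proof.
have h := fconnect_base K a.
by exists (findex rot_around (base K (vert a)) a); [exact: findex_max|exact: iter_findex].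
Qed.

Lemma around_inj w i j : (i < deg w)%N -> (j < deg w)%N ->
  around w i = around w j -> i = j.
Proof.
move=> id jd ij; rewrite -(@findex_iter _ rot_around (base K w) i id).
by rewrite -/(around w i) ij /around findex_iter.
Qed.

Lemma sideC a : side (opp a) =1 side a.
Proof. by move=> b; rewrite /side oppK orbC. Qed.

Lemma side_vertN a b : vert b != vert a -> vert b != vert (nextc a) -> side a b = false.
Proof.
move=> ba bna; apply/negbTE; rewrite negb_or; apply/andP; split.
  by apply: contraNneq ba => ->.
by apply: contraNneq bna => ->; rewrite vert_opp.
Qed.

Lemma side_vert a b : vert b = vert a -> side a b = (b == a).
Proof.
move=> ba; rewrite /side; case: (b =P opp a) => [bE|]; last by rewrite orbF.
by have := vert_nextc K a; rewrite -vert_opp -bE ba eqxx.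
Qed.

Local Notation hatd w := (@hat R (deg w)).
Local Notation gauged w := (@gauge R (deg w)).

(** A single formula in the hats for all triangles around [w], so that continuity requires no
    pasting along spokes. The products of consecutive hats serve the edges opposite [w]. *)
Definition star_param w z : space := fun i =>
  match i with
  | inl v => (1 - gauged w z) * (v == w)%:R +
      \sum_(i < deg w) hatd w i z * (v == vert (nextc (around w i)))%:R
  | inr b => \sum_(i < deg w)
        hatd w i z * ((1 - gauged w z) * (side (around w i) b)%:R) +
      \sum_(i < deg w) hatd w i z * hatd w (i.+1 %% deg w) z *
        (side (nextc (around w i)) b)%:R
  end.

Lemma star_param_sect w k (s t : R) : (k < deg w)%N -> 0 <= s -> 0 <= t ->
  star_param w (sect (deg w) k s t) = point_of (around w k) (1 - (s + t)) s t.
Proof.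
move=> kd s0 t0; have d4 := deg_ge4 K w.
have nE : nextc (around w k.+1) = nextc (opp (nextc (nextc (around w k)))) by [].
apply/funext => -[v|b] /=; rewrite gauge_sect//.
  rewrite (sum_hat d4 (fun i => (v == vert (nextc (around w i)))%:R))//.
  by rewrite -[around w (_ %% _)]/(around w _) around_mod nE vert_nextc_opp vert_around addrA.
rewrite (sum_hat d4 (fun i => (1 - (s + t)) * (side (around w i) b)%:R))//.
rewrite (sum_hat2 d4 (fun i => (side (nextc (around w i)) b)%:R))// around_mod.
have -> : around w k.+1 = opp (nextc (nextc (around w k))) by [].
rewrite sideC; ring.
Qed.

Lemma continuous_star_param w : continuous (star_param w).
Proof.
have ch k : real_continuous (hatd w k) by exact: continuous_hat.
have cg : real_continuous (gauged w) by exact: continuous_gauge.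
by apply: continuous_ptws => -[v|b] /=; prove_continuous.
Qed.

(** In a triangle at [w], the coordinate of a spoke is the weight of [w] times the weight of the
    other end; the division recovers the latter, which is the coefficient of the corresponding
    corner. *)
Definition star_map w (x : space) : R * R :=
  ((\sum_(i < deg w) x (inr (around w i)) * (corner R (deg w) i).1) / x (inl w),
   (\sum_(i < deg w) x (inr (around w i)) * (corner R (deg w) i).2) / x (inl w)).

Lemma point_of_vert a t0 t1 t2 : point_of a t0 t1 t2 (inl (vert a)) = t0.
Proof.
rewrite /= eqxx mulr1 (negbTE (_ : vert a != vert (nextc a))) ?(eq_sym (vert a)) ?vert_nextc//.
by rewrite (negbTE (vert_nextc2 a)) !mulr0 !addr0.
Qed.

Lemma star_map_point_of w k t0 t1 t2 : (k < deg w)%N -> t0 != 0 ->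
  star_map w (point_of (around w k) t0 t1 t2) = sect (deg w) k t1 t2.
Proof.
move=> kd t00; have d0 := deg_gt0 w; have d4 := deg_ge4 K w.
set c := around w k.
have vc : vert c = w by exact: vert_around.
have xw : point_of c t0 t1 t2 (inl w) = t0 by rewrite -{1}vc point_of_vert.
have xi i : (i < deg w)%N -> point_of c t0 t1 t2 (inr (around w i)) =
    t0 * (t1 * (i == k)%:R + t2 * (i == k.+1 %% deg w :> nat)%N%:R).
  move=> id /=; have vi : vert (around w i) = w by exact: vert_around.
  have n1 : vert (around w i) != vert (nextc c).
    by rewrite vi -[X in X != _]vc eq_sym vert_nextc.
  have n2 : vert (around w i) != vert (nextc (nextc c)).
    by rewrite vi -[X in X != _]vc eq_sym vert_nextc2.
  rewrite (side_vertN n1 n2) -(sideC (nextc (nextc c))) !side_vert ?vi//; last first.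
    by rewrite -[opp _]/(around w k.+1) vert_around.
  have -> : (around w i == c) = (i == k).
    by apply/eqP/eqP => [h|->//]; exact: (around_inj id kd h).
  (* The third edge of the triangle runs into [w]; reversed, it is the next spoke. *)
  have -> : (around w i == opp (nextc (nextc c))) = (i == k.+1 %% deg w)%N.
    rewrite -[opp _]/(around w k.+1) -(around_mod w k.+1).
    apply/eqP/eqP => [h|->//].
    exact: (around_inj id (ltn_pmod _ d0) h).
  by rewrite mulr0 addr0; ring.
have sumE (F : nat -> R) :
    (\sum_(i < deg w) point_of c t0 t1 t2 (inr (around w i)) * F i) / t0 =
    t1 * F k + t2 * F (k.+1 %% deg w)%N.
  have k1d : (k.+1 %% deg w < deg w)%N by rewrite ltn_mod.
  rewrite -(sum_indicator t1 F kd) -(sum_indicator t2 F k1d) -big_split.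
  rewrite mulr_suml; apply: eq_bigr => i _; rewrite xi//.
  by rewrite -[RHS]/(_ + _); field.
rewrite /star_map xw (sumE (fun i => (corner R (deg w) i).1)).
by rewrite (sumE (fun i => (corner R (deg w) i).2)) !corner_mod.
Qed.

(** A nonzero weight at [w] makes [w] a vertex of the triangle; renaming the corners cyclically puts
    it first. *)
Lemma body_star w x : body x -> x (inl w) != 0 -> exists k t0 t1 t2,
  [/\ (k < deg w)%N, simplex t0 t1 t2, t0 = x (inl w) &
      x = point_of (around w k) t0 t1 t2].
Proof.
move=> [a [t0 [t1 [t2 [st xE]]]]] xw.
have st1 : simplex t1 t2 t0.
  by case: st => ? ? ? h; split => //; lra.
have st2 : simplex t2 t0 t1.
  by case: st1 => ? ? ? h; split => //; lra.
have main a' s0 s1 s2 : simplex s0 s1 s2 -> x = point_of a' s0 s1 s2 -> vert a' = w ->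
    exists k t0 t1 t2, [/\ (k < deg w)%N, simplex t0 t1 t2, t0 = x (inl w) &
      x = point_of (around w k) t0 t1 t2].
  move=> ss xE' aw; have [k kd ka] := around_surj a'.
  rewrite aw in kd ka; exists k, s0, s1, s2; split => //; last by rewrite ka.
  by rewrite xE' -aw point_of_vert.
have [e|/eqP n0] := eqVneq (vert a) w; first exact: (main a t0 t1 t2).
have [e|/eqP n1] := eqVneq (vert (nextc a)) w.
  by apply: (main (nextc a) t1 t2 t0) => //; rewrite point_of_nextc.
have [e|/eqP n2] := eqVneq (vert (nextc (nextc a))) w.
  by apply: (main (nextc (nextc a)) t2 t0 t1) => //; rewrite !point_of_nextc.
case/eqP: xw; rewrite xE /=; do 3 (case: eqP => [/esym//|_]).
by rewrite !mulr0 !addr0.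
Qed.

Lemma simplex_sect (s t : R) : 0 <= s -> 0 <= t -> s + t <= 1 ->
  simplex (1 - (s + t)) s t.
Proof. by move=> s0 t0 st; split => //; [rewrite subr_ge0|ring]. Qed.

Lemma star_param_body w z : gauged w z <= 1 -> body (star_param w z).
Proof.
have [k [s [t [kd s0 t0 ->]]]] := sect_exists (deg_ge4 K w) z.
rewrite gauge_sect ?deg_ge4// => st; rewrite star_param_sect//.
by exists (around w k), (1 - (s + t)), s, t; split => //; exact: simplex_sect.
Qed.

Lemma star_param_vert w z : star_param w z (inl w) = 1 - gauged w z.
Proof.
have d4 := deg_ge4 K w; have [k [s [t [kd s0 t0 ->]]]] := sect_exists d4 z.
by rewrite star_param_sect// gauge_sect// -{2}(vert_around w k) point_of_vert.
Qed.

Lemma star_paramK w z : gauged w z < 1 -> star_map w (star_param w z) = z.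
Proof.
have d4 := deg_ge4 K w; have [k [s [t [kd s0 t0 ->]]]] := sect_exists d4 z.
rewrite gauge_sect// => st; rewrite star_param_sect// star_map_point_of//.
by rewrite subr_eq0 gt_eqF.
Qed.

Lemma star_mapK w x : body x -> 0 < x (inl w) ->
  gauged w (star_map w x) < 1 /\ star_param w (star_map w x) = x.
Proof.
move=> xb xw; have [k [t0 [t1 [t2 [kd [p0 p1 p2 p3] t0E xE]]]]] :=
  body_star xb (lt0r_neq0 xw).
have t00 : 0 < t0 by rewrite t0E.
rewrite xE star_map_point_of ?gt_eqF// gauge_sect ?deg_ge4//.
split; first by rewrite -p3; lra.
by rewrite star_param_sect//; congr point_of; rewrite -p3; ring.
Qed.

End Triangulation.

(** * Charts, compactness and connectedness of the glued space *)

Section GluedSurface.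
Variables (R : realType) (C W : finType) (K : triangulation C W).
Implicit Types (a b : C) (w : W) (t : R) (z : R * R).
Local Notation nextc := (nextc K).
Local Notation opp := (opp K).
Local Notation vert := (vert K).
Local Notation deg := (deg K).
Local Notation around := (around K).
Local Notation body := (@body R _ _ K).
Local Notation glued := (glued R K).
Local Notation gauged w := (@gauge R (deg w)).
Local Notation star_param := (@star_param R _ _ K).
Local Notation star_map := (@star_map R _ _ K).
Local Notation point_of := (@point_of R _ _ K).

Lemma center_proof w : star_param w (0, 0) \in body.
Proof.
by apply/mem_set/star_param_body; rewrite (gauge0 R (deg_ge4 K w)).
Qed.

(** Outside the polygon [star_param w z] need not belong to [body]; the centre of the star serves as
    default value. *)
Definition star_inv w z : glued :=
  insubd (exist _ (star_param w (0, 0)) (center_proof w) : glued) (star_param w z).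

Definition star w : set glued := [set x | 0 < \val x (inl w)].

(** An image of the closed polygon, hence compact and connected, although boundary points may be
    identified. *)
Definition closed_star w : set glued := star_inv w @` [set z | gauged w z <= 1].

Lemma val_star_inv w z : gauged w z <= 1 -> \val (star_inv w z) = star_param w z.
Proof. by move=> sz; rewrite /star_inv insubdK//; apply/mem_set/star_param_body. Qed.

Lemma glued_body (x : glued) : body (\val x).
Proof. exact: set_valP. Qed.

Lemma continuous_star_inv w : {within [set z | gauged w z <= 1], continuous (star_inv w)}.
Proof.
apply: within_continuous_insubd; first exact: star_param_body.
by apply: continuous_subspaceT; exact: continuous_star_param.
Qed.

Lemma real_continuous_coord i : real_continuous (fun x : glued => \val x i).
Proof.
move=> x; apply: (@continuous_comp _ _ _ (\val : glued -> _) (fun y => y i)).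
  exact: continuous_set_val.
exact: real_continuous_proj.
Qed.

Lemma open_star w : open (star w).
Proof. by apply: open_real_gt; exact: real_continuous_coord. Qed.

Lemma star_homeo w : homeo_between (star w) [set z | gauged w z < 1]
  (fun x => star_map w (\val x)) (star_inv w).
Proof.
split.
- by move=> x xw; exact: (star_mapK (glued_body x) xw).1.
- move=> z /= sz; rewrite /star /= val_star_inv ?(ltW sz)//.
  by rewrite star_param_vert subr_gt0.
- move=> x xw; have [h1 h2] := star_mapK (glued_body x) xw.
  by apply/val_inj; rewrite val_star_inv ?(ltW h1).
- by move=> z /= sz; rewrite val_star_inv ?(ltW sz)// star_paramK.
- split; last first.
    have sub : [set z | gauged w z < 1] `<=` [set z | gauged w z <= 1].
      by move=> z /= /ltW.
    exact: (continuous_subspaceW sub (@continuous_star_inv w)).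
  apply: continuous_in_subspaceT => x /set_mem xw.
  have cw : (fun y : glued => (\val y (inl w))^-1) @ x --> (\val x (inl w))^-1.
    have xn : \val x (inl w) != 0 by rewrite gt_eqF.
    exact: (cvgV xn (@real_continuous_coord (inl w) x)).
  have cn (F : nat -> R) : real_continuous
      (fun y : glued => \sum_(i < deg w) \val y (inr (around w i)) * F i).
    apply: real_continuous_sum => i; apply: real_continuousM.
      exact: real_continuous_coord.
    exact: real_continuous_cst.
  exact: (cvg_pair (cvgM (cn (fun i => (corner R (deg w) i).1) x) cw)
                   (cvgM (cn (fun i => (corner R (deg w) i).2) x) cw)).
Qed.

Definition star_chart w : chart R glued :=
  Chart (open_star w) (@open_gauge R (deg w)) (star_homeo w).

Lemma glued_closed_star (x : glued) a t0 t1 t2 : simplex t0 t1 t2 ->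
  \val x = point_of a t0 t1 t2 -> closed_star (vert a) x.
Proof.
move=> [p0 p1 p2 p3] xE; have [k kd ka] := around_surj K a.
have d4 := deg_ge4 K (vert a).
exists (sect (deg (vert a)) k t1 t2); first by rewrite /= gauge_sect//; lra.
apply/val_inj; rewrite val_star_inv ?gauge_sect//; last by lra.
by rewrite star_param_sect// ka xE; congr point_of; lra.
Qed.

Lemma compact_closed_star w : compact (closed_star w).
Proof.
apply: continuous_compact; first exact: continuous_star_inv.
exact: compact_gauge (deg_ge4 K w).
Qed.

Lemma connected_closed_star w : connected (closed_star w).
Proof.
apply: connected_continuous_connected; last exact: continuous_star_inv.
exact: connected_gauge_le (deg_ge4 K w).
Qed.

Lemma hausdorff_glued : hausdorff_space glued.
Proof.
apply: hausdorff_set_type; apply: (@hausdorff_product _ (fun=> R)) => _.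
exact: Rhausdorff.
Qed.

Lemma compact_glued : compact [set: glued].
Proof.
have -> : [set: glued] = \big[setU/set0]_(w <- enum W) closed_star w.
  apply/seteqP; split => // x _; rewrite -bigcup_seq.
  have [a [t0 [t1 [t2 [st xE]]]]] := glued_body x.
  by exists (vert a); [rewrite /= mem_enum|exact: glued_closed_star st xE].
by apply: bigsetU_compact => w _; exact: compact_closed_star.
Qed.

Lemma glued_vert_pos (x : glued) : exists w, star w x.
Proof.
have [a [t0 [t1 [t2 [[p0 p1 p2 p3] xE]]]]] := glued_body x.
have [t00|t00] := ltP 0 t0; first by exists (vert a); rewrite /star /= xE point_of_vert.
have [t10|t10] := ltP 0 t1.
  by exists (vert (nextc a)); rewrite /star /= xE -point_of_nextc point_of_vert.
exists (vert (nextc (nextc a))); rewrite /star /= xE -2!point_of_nextc point_of_vert; lra.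
Qed.

Lemma surface_glued : connected [set: glued] -> surface R glued.
Proof.
move=> conn; split => //; first exact: hausdorff_glued.
  exact: compact_glued.
by move=> x; have [w xw] := glued_vert_pos x; exists (star_chart w).
Qed.

(** Meant for the two disc centres: every triangle has one of them as a vertex, so their closed
    stars cover the space, and both contain the common neighbour [y]. *)
Lemma connected_glued (w1 w2 : W) (a1 a2 : C) :
  vert a1 = w1 -> vert a2 = w2 -> vert (nextc a1) = vert (nextc a2) ->
  (forall a, exists b, vert b \in [:: w1; w2] /\
     (b = a \/ b = nextc a \/ b = nextc (nextc a))) ->
  connected [set: glued].
Proof.
move=> v1 v2 v12 cover.
have st : simplex (0 : R) 1 0 by split => //; ring.
have [y yE] : exists y : glued, \val y = point_of a1 0 1 0.
  have yb : point_of a1 0 1 0 \in body by apply/mem_set; exists a1, 0, 1, 0.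
  by exists (exist (fun x => x \in body) _ yb).
have y1 : closed_star w1 y by rewrite -v1; exact: glued_closed_star st yE.
have y2 : closed_star w2 y.
  rewrite -v2; apply: glued_closed_star st _; rewrite yE.
  by apply/funext => -[w|b] /=; rewrite ?v12 !(mul0r, mulr0, mul1r, add0r, addr0).
have -> : [set: glued] = closed_star w1 `|` closed_star w2.
  apply/seteqP; split => // z _.
  have [a [t0 [t1 [t2 [sz zE]]]]] := glued_body z.
  have [b [bw ba]] := cover a.
  have zb : closed_star (vert b) z.
    case: sz => p0 p1 p2 p3; case: ba => [->|[->|->]].
    - by apply: (@glued_closed_star _ _ t0 t1 t2).
    - by apply: (@glued_closed_star _ _ t1 t2 t0); rewrite ?point_of_nextc//; split => //; lra.
    - by apply: (@glued_closed_star _ _ t2 t0 t1); rewrite ?point_of_nextc//; split => //; lra.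
  by move: bw zb; rewrite !inE => /orP[/eqP->|/eqP->]; [left|right].
apply: connectedU; [by exists y|exact: connected_closed_star|exact: connected_closed_star].
Qed.

End GluedSurface.

(** * Transitions between stars *)

Section Orientation.
Variables (R : realType) (C W : finType) (K : triangulation C W).
Implicit Types (w : W) (z : R * R).
Local Notation nextc := (nextc K).
Local Notation vert := (vert K).
Local Notation deg := (deg K).
Local Notation around := (around K).
Local Notation glued := (glued R K).
Local Notation gauged w := (@gauge R (deg w)).
Local Notation star_param := (@star_param R _ _ K).
Local Notation star_map := (@star_map R _ _ K).
Local Notation delta w := (central_angle R (deg w)).

Lemma cornerS d k : corner R d k.+1 =
  ((corner R d k).1 * cos (central_angle R d) -
     (corner R d k).2 * sin (central_angle R d),
   (corner R d k).2 * cos (central_angle R d) +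
     (corner R d k).1 * sin (central_angle R d)).
Proof. by rewrite !cornerE -natr1 mulrDl mul1r cosD sinD/=; congr pair; ring. Qed.

Lemma corner_prev d k : corner R d k =
  ((corner R d k.+1).1 * cos (central_angle R d) +
     (corner R d k.+1).2 * sin (central_angle R d),
   (corner R d k.+1).2 * cos (central_angle R d) -
     (corner R d k.+1).1 * sin (central_angle R d)).
Proof.
have cs := cos2sin2 (central_angle R d).
by rewrite cornerS [LHS]surjective_pairing/=; congr pair; ring: cs.
Qed.

Lemma corner_norm d k : (corner R d k).1 ^+ 2 + (corner R d k).2 ^+ 2 = 1.
Proof. by rewrite cornerE/= cos2Dsin2. Qed.

Lemma succ_mod_neq d k : (4 <= d)%N -> (k < d)%N -> (k.+1 %% d != k)%N.
Proof. by case: (k.+1 =P d) => [e|ne] ? ?; [rewrite e modnn|rewrite modn_small]; lia. Qed.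

(** The direction from [w] to [w'] is [eta] in the polygon of [w], and [phi] in that of [w'], where
    [w] sits at corner [j.+1]. In these frames the third vertex of an adjacent triangle moves from
    [(cos delta, sin delta)] to [(1 - cos delta', sin delta')], up to the sign of the second
    coordinate; this determines [kappa] and [mu]. *)
Lemma star_transition w w' i j z :
  (i < deg w)%N -> (j < deg w')%N -> around w' j = nextc (around w i) ->
  0 < hat (deg w) i z ->
  let eta := i%:R * delta w in
  let phi := j.+1%:R * delta w' + pi in
  let kappa := (1 - cos (delta w) - cos (delta w')) / sin (delta w) in
  let mu := sin (delta w') / sin (delta w) in
  let a := z.1 * cos eta + z.2 * sin eta in
  let b := z.2 * cos eta - z.1 * sin eta in
  star_map w' (star_param w z) =
    ((corner R (deg w') j.+1).1 + ((a + kappa * `|b|) * cos phi - mu * b * sin phi),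
     (corner R (deg w') j.+1).2 + ((a + kappa * `|b|) * sin phi + mu * b * cos phi)).
Proof.
move=> id jd ij hi eta phi kappa mu.
have d4 := deg_ge4 K w; have d0 := deg_gt0 K w; have d'0 := deg_gt0 K w'.
have s0 := sin_central_angle_gt0 R d4; have sn : sin (delta w) != 0 by rewrite gt_eqF.
have cphi : cos phi = - (corner R (deg w') j.+1).1 by rewrite cosDpi cornerE.
have sphi : sin phi = - (corner R (deg w') j.+1).2 by rewrite sinDpi cornerE.
have [k [a [b [kd a0 b0 zE]]]] := sect_exists d4 z.
have kn := succ_mod_neq d4 kd.
(* A positive hat leaves the two sectors along spoke [i], one on each side of the axis; [|b|] merges
   their two affine formulas. *)
move: hi; rewrite zE hat_sectE//; case: (i =P k) => [ik|/eqP ik] hi.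
  subst k.
  have {hi}a_gt0 : 0 < a by move: hi; rewrite (eq_sym i) (negbTE kn) mulr1 mulr0 addr0.
  have ceta : cos eta = (corner R (deg w) i).1 by rewrite /eta cornerE.
  have seta : sin eta = (corner R (deg w) i).2 by rewrite /eta cornerE.
  rewrite star_param_sect// -point_of_nextc -ij star_map_point_of ?gt_eqF//.
  rewrite ceta seta cphi sphi /sect.
  move: (corner_norm (deg w) i) (cornerS (deg w) i) (corner_prev (deg w') j).
  case: (corner R (deg w) i) (corner R (deg w) i.+1) => c s [c1 s1].
  case: (corner R (deg w') j.+1) (corner R (deg w') j) => c' s' [c'1 s'1] /= cs.
  move=> [-> ->] [-> ->].
  have {}cs : c ^+ 2 = 1 - s ^+ 2 by rewrite -cs addrK.
  set a_ := (X in X + kappa * _); set b_ := (X in `|X|).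
  have aE : a_ = a + b * cos (delta w) by rewrite /a_; ring: cs.
  have bE : b_ = b * sin (delta w) by rewrite /b_; ring: cs.
  rewrite -!/a_ -!/b_ aE bE ger0_norm ?mulr_ge0 ?(ltW s0)// /kappa /mu.
  by congr pair; field.
have {ik}ik : i = (k.+1 %% deg w)%N.
  by apply/eqP; apply: contraTT hi => /negbTE ->; rewrite !mulr0 addr0 ltxx.
have {hi}b_gt0 : 0 < b.
  by move: hi; rewrite ik eqxx mulr1 mulr0 add0r.
have cetaE : (cos eta, sin eta) = corner R (deg w) k.+1.
  by rewrite -corner_mod// -ik cornerE.
have ceta : cos eta = (corner R (deg w) k.+1).1 by rewrite -cetaE.
have seta : sin eta = (corner R (deg w) k.+1).2 by rewrite -cetaE.
have nnE : nextc (nextc (around w k)) = around w' (j.+1 %% deg w').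
  rewrite around_mod -[RHS]/(opp K (nextc (nextc (around w' j)))) ij nextc3 ik.
  by rewrite around_mod -[in RHS]/(opp K (nextc (nextc (around w k)))) oppK.
rewrite star_param_sect// -2!point_of_nextc nnE star_map_point_of ?gt_eqF ?ltn_mod//.
rewrite sect_mod// ceta seta cphi sphi /sect.
move: (corner_norm (deg w) k.+1) (corner_prev (deg w) k) (cornerS (deg w') j.+1).
case: (corner R (deg w) k.+1) (corner R (deg w) k) => c s [c1 s1].
case: (corner R (deg w') j.+1) (corner R (deg w') j.+2) => c' s' [c'1 s'1] /= cs.
move=> [-> ->] [-> ->].
have {}cs : c ^+ 2 = 1 - s ^+ 2 by rewrite -cs addrK.
set a_ := (X in X + kappa * _); set b_ := (X in `|X|).
have aE : a_ = b + a * cos (delta w) by rewrite /a_; ring: cs.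
have bE : b_ = - (a * sin (delta w)) by rewrite /b_; ring: cs.
rewrite -!/a_ -!/b_ aE bE normrN ger0_norm ?mulr_ge0 ?(ltW s0)// /kappa /mu.
by congr pair; field.
Qed.

Lemma orientable_glued : orientable R glued.
Proof.
exists [set c | exists w, c = @star_chart R _ _ K w]; split.
  by move=> x; have [w xw] := glued_vert_pos x; exists (star_chart R K w) => //; exists w.
move=> _ _ [w ->] [w' ->] x /= xw xw'.
have d4 := deg_ge4 K w; have d4' := deg_ge4 K w'.
have [p1 pK] := star_mapK (glued_body x) xw.
set p := star_map w (\val x) in p1 pK *.
have np : nbhs p [set z | gauged w z < 1].
  by apply: open_nbhs_nbhs; split => //; exact: open_gauge.
have hE z : gauged w z < 1 ->
    (chart_map (star_chart R K w') \o chart_inv (star_chart R K w)) z =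
    star_map w' (star_param w z).
  move=> z1; rewrite -[LHS]/(star_map w' (\val (star_inv K w z))).
  by rewrite val_star_inv// ltW.
have [ww'|ww'] := eqVneq w w'.
  apply: (@orientation_preserving_fold R _ p (0, 0) 0 1 0 0) => //.
  apply: filterS np => z z1; rewrite hE// -ww' star_paramK//.
  by rewrite /= cos0 sin0 [LHS]surjective_pairing; congr pair; ring.
have [k [t0 [t1 [t2 [kd [q0 q1 q2 q3] t0E xE]]]]] :=
  body_star (glued_body x) (lt0r_neq0 xw).
have t00 : 0 < t0 by rewrite t0E.
have pE : p = sect (deg w) k t1 t2 by rewrite /p xE star_map_point_of// gt_eqF.
(* Several spokes may join [w] to [w']; the triangle containing [x] selects one. *)
have [i [id vi hi]] : exists i, [/\ (i < deg w)%N, vert (nextc (around w i)) = w' &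
    0 < hat (deg w) i p].
  have kn := succ_mod_neq d4 kd.
  move: xw'; rewrite /star /= xE /= vert_around (eq_sym w') (negbTE ww') mulr0 add0r.
  case: eqP => [e1|_].
    rewrite {1}e1 (eq_sym (vert _)) (negbTE (vert_nextc _ _)) mulr0 addr0 mulr1 => t10.
    exists k; split => //.
    by rewrite pE hat_sectE// eqxx (eq_sym k) (negbTE kn) mulr0 addr0 mulr1.
  case: eqP => [e2|_]; last by rewrite !mulr0 addr0 ltxx.
  rewrite mulr0 add0r mulr1 => t20; exists (k.+1 %% deg w)%N; split.
  - by rewrite ltn_mod deg_gt0.
  - rewrite around_mod e2.
    exact: (vert_nextc_opp K (nextc (nextc (around w k)))).
  - rewrite pE hat_sectE//; last by rewrite ltn_mod deg_gt0.
    by rewrite eqxx (negbTE kn) mulr0 add0r mulr1.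
have [j jd ij] := around_surj K (nextc (around w i)); rewrite vi in jd ij.
have nh : nbhs p [set z | 0 < hat (deg w) i z].
  apply: open_nbhs_nbhs; split => //; apply: open_real_gt; exact: continuous_hat.
apply: (@orientation_preserving_fold R _ p (corner R (deg w') j.+1) _ _ _ _ _); last first.
  apply: filterS2 np nh => z z1 hz; rewrite hE//.
  exact: star_transition id jd ij hz.
by rewrite divr_gt0// sin_central_angle_gt0.
Qed.

End Orientation.

(** * Pairs of Eulerian circuits *)

(* Two Eulerian circuits [black] and [white] along the same arcs of an oriented
   graph: each maps an arc to the one that it traverses next. At every vertex,
   following [white] and then [black] backwards runs through all incoming arcs,
   so that gluing a disc along each circuit makes a surface. *)
Record euler_pair (V E : finType) := EulerPair {
  tail : E -> V;
  head : E -> V;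
  black : E -> E;
  white : E -> E;
  black_inj : injective black;
  white_inj : injective white;
  tail_black : forall e, tail (black e) = head e;
  tail_white : forall e, tail (white e) = head e;
  arc0 : E;
  black_cycle : forall e, fconnect black arc0 e;
  white_cycle : forall e, fconnect white arc0 e;
  rotation_cycle : forall e e', head e = head e' ->
    fconnect (finv black \o white) e e';
  ends_inj : injective (fun e => [set tail e; head e]%SET);
  tail_neq_head : forall e, tail e != head e;
  arc_into : V -> E;
  head_arc_into : forall v, head (arc_into v) = v;
  card_arcs_ge4 : (4 <= #|E|)%N }.

(** * The triangulation obtained by coning both circuits *)

Section EulerTriangulation.
Variables (V E : finType) (P : euler_pair V E).
Implicit Types (e : E) (v : V).
Local Notation tail := (tail P).
Local Notation head := (head P).
Local Notation black := (black P).
Local Notation white := (white P).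

(* The triangle [(true, e)] joins the centre of the black disc ([None]) to the
   tail and to the head of [e]; the triangle [(false, e)] joins the centre of the
   white disc to the head and to the tail of [e], because the two discs lie on
   opposite sides of [e]. *)
Definition tcorner : finType := (bool * E * option bool)%type.

Definition first_end (f : bool) e := if f then tail e else head e.
Definition second_end (f : bool) e := if f then head e else tail e.

Definition tvert (c : tcorner) : V + bool :=
  let: (f, e, k) := c in
  match k with
  | None => inr f
  | Some false => inl (first_end f e)
  | Some true => inl (second_end f e)
  end.

Definition tnext (c : tcorner) : tcorner :=
  let: (f, e, k) := c in
  (f, e, match k with None => Some false | Some false => Some true | _ => None end).

(** The order of the arcs around a disc in the chosen orientation: the white circuit is read
    backwards. *)
Definition disc_succ (f : bool) : E -> E := if f then black else finv white.
Definition disc_pred (f : bool) : E -> E := if f then finv black else white.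

(** Across an edge of the graph lies the triangle of the other colour on the same arc; across a
    spoke, the neighbouring triangle of the same disc. *)
Definition topp (c : tcorner) : tcorner :=
  let: (f, e, k) := c in
  match k with
  | None => (f, disc_pred f e, Some true)
  | Some false => (~~ f, e, Some false)
  | Some true => (f, disc_succ f e, None)
  end.

Definition tbase (w : V + bool) : tcorner :=
  match w with
  | inl v => (true, arc_into P v, Some true)
  | inr f => (f, arc0 P, None)
  end.

Definition trot (c : tcorner) := topp (tnext (tnext c)).

Lemma disc_succK f : cancel (disc_succ f) (disc_pred f).
Proof. by case: f => e /=; [apply: finv_f; exact: black_inj|apply: f_finv; exact: white_inj]. Qed.

Lemma disc_predK f : cancel (disc_pred f) (disc_succ f).
Proof. by case: f => e /=; [apply: f_finv; exact: black_inj|apply: finv_f; exact: white_inj]. Qed.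

Lemma first_disc_succ f e : first_end f (disc_succ f e) = second_end f e.
Proof.
case: f => /=; first exact: tail_black.
by rewrite -[in RHS](f_finv (@white_inj _ _ P) e) tail_white.
Qed.

Lemma second_disc_pred f e : second_end f (disc_pred f e) = first_end f e.
Proof. by rewrite -first_disc_succ disc_predK. Qed.

Lemma tnext3 c : tnext (tnext (tnext c)) = c.
Proof. by case: c => [[f e] [[]|]]. Qed.

Lemma toppK : involutive topp.
Proof.
by case=> [[f e] [[]|]]; rewrite /topp ?disc_succK ?disc_predK ?negbK.
Qed.

Lemma tvert_topp c : tvert (topp c) = tvert (tnext c).
Proof.
case: c => [[f e] [[]|]] //=; last by rewrite second_disc_pred.
by case: f.
Qed.

Lemma first_neq_second f e : first_end f e != second_end f e.
Proof. by case: f; rewrite /= ?(eq_sym (head e)) tail_neq_head. Qed.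

Lemma tvert_tnext c : tvert (tnext c) != tvert c.
Proof.
case: c => [[f e] [[]|]] //=.
by apply/eqP => -[/eqP]; rewrite eq_sym (negbTE (first_neq_second f e)).
Qed.

Lemma tvert_tbase w : tvert (tbase w) = w.
Proof. by case: w => [v|f] //=; rewrite head_arc_into. Qed.

Lemma iter_trot_center f e n : iter n trot (f, e, None) = (f, iter n (disc_succ f) e, None).
Proof. by elim: n => //= n ->. Qed.

Lemma disc_cycle f e : fconnect (disc_succ f) (arc0 P) e.
Proof.
case: f => /=; first exact: black_cycle.
by rewrite (same_fconnect_finv (@white_inj _ _ P)); exact: white_cycle.
Qed.

(** Each incoming arc accounts for four successive corners at a vertex, of the triangles black [e],
    white [e], white [white e], black [white e]; the fifth is that of black [finv black (white e)].
    Thus [rotation_cycle] reaches all incoming arcs, and the remaining corners follow within a turn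
    of four. *)
Lemma fconnect_tbase c : fconnect trot (tbase (tvert c)) c.
Proof.
have center f e : fconnect trot (tbase (inr f)) (f, e, None).
  by rewrite -(iter_findex (disc_cycle f e)) -iter_trot_center fconnect_iter.
have rot4 e n : iter (4 * n) trot (true, e, Some true) =
    (true, iter n (finv black \o white) e, Some true).
  by elim: n => [|n IH]; rewrite ?muln0// mulnS iterD IH.
have second e : fconnect trot (tbase (inl (head e))) (true, e, Some true).
  have h : head (arc_into P (head e)) = head e by rewrite head_arc_into.
  by rewrite -[in X in fconnect _ _ X](iter_findex (rotation_cycle h)) -rot4 fconnect_iter.
have step c' w : fconnect trot (tbase w) c' -> fconnect trot (tbase w) (trot c').
  by move=> h; apply: connect_trans h _; exact: fconnect1.
have first e : fconnect trot (tbase (inl (head e))) (false, e, Some false).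
  exact: (step (true, e, Some true)).
have third e : fconnect trot (tbase (inl (tail e))) (false, e, Some true).
  (* The outgoing arc [e] comes up right after the incoming arc that precedes it in the white
     circuit. *)
  have wK := f_finv (@white_inj _ _ P) e.
  rewrite -[in inl _]wK tail_white.
  have := step _ _ (first (finv white e)).
  by rewrite -[trot _]/(false, white (finv white e), Some true) wK.
case: c => [[[] e] [[]|]] //=; first exact: second.
- exact: (step _ _ (third e)).
- exact: center.
- exact: third.
- exact: first.
- exact: center.
Qed.

Lemma order_trot_center f : order trot (tbase (inr f)) = #|E|.
Proof.
rewrite -(card_codom (f := fun e : E => (f, e, None) : tcorner)); last by move=> e e' [].
apply: eq_card => c; apply/idP/codomP => [h|[e ->]]; last exact: (fconnect_tbase (f, e, None)).
have : tvert c = inr f.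
  rewrite -(iter_findex h); elim: (findex _ _ _) => //= n IH.
  by rewrite -IH tvert_topp tnext3.
by case: c {h} => [[f' e] [[]|]] //= [->]; exists e.
Qed.

(** At a vertex of the graph, the first four corners already differ in colour or in kind. *)
Lemma order_trot_ge4 w : (4 <= order trot (tbase w))%N.
Proof.
case: w => [v|f]; last by rewrite order_trot_center (card_arcs_ge4 P).
pose c i := iter i trot (tbase (inl v)).
apply/card_geqP; exists [:: c 0%N; c 1%N; c 2%N; c 3%N]; split => //.
  by rewrite /= !inE !xpair_eqE /= !andbF.
by move=> x; rewrite !inE => /or4P[] /eqP ->; exact: fconnect_iter.
Qed.

Definition euler_triangulation : triangulation tcorner (V + bool)%type :=
  Triangulation tnext3 toppK tvert_topp tvert_tnext tvert_tbase fconnect_tbase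
    order_trot_ge4.

Lemma around_center f n :
  around euler_triangulation (inr f) n = (f, iter n (disc_succ f) (arc0 P), None).
Proof. exact: iter_trot_center. Qed.

Lemma deg_center f : deg euler_triangulation (inr f) = #|E|.
Proof. exact: order_trot_center. Qed.

(** On the white side the arcs come in reverse order, and each is traversed from its head. *)
Definition disc_circuit (f : bool) : seq V :=
  map (first_end f) (orbit (disc_succ f) (arc0 P)).

Lemma disc_succ_inj f : injective (disc_succ f).
Proof. exact: can_inj (disc_succK f). Qed.

Lemma order_disc f : order (disc_succ f) (arc0 P) = #|E|.
Proof. by apply: eq_card => e; rewrite inE disc_cycle. Qed.

Lemma size_disc_circuit f : size (disc_circuit f) = #|E|.
Proof. by rewrite size_map size_orbit order_disc. Qed.

Lemma rot1_orbit (T : finType) (g : T -> T) x : injective g ->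
  rot 1 (orbit g x) = map g (orbit g x).
Proof.
move=> gI; have ox := iter_order gI x.
rewrite /orbit; case: (order g x) (order_gt0 g x) ox => // m _ ox.
rewrite [in LHS]trajectS rot1_cons -{2}ox iterSr -trajectSr.
by elim: m.+1 (x) => //= k IH y; rewrite IH.
Qed.

Lemma rot1_disc_circuit f :
  rot 1 (disc_circuit f) = map (second_end f) (orbit (disc_succ f) (arc0 P)).
Proof.
rewrite -map_rot rot1_orbit -?map_comp; last exact: disc_succ_inj.
by apply: eq_map => e /=; rewrite first_disc_succ.
Qed.

Lemma walk_edges_disc f : walk_edges (disc_circuit f) =
  [seq [set tail e; head e]%SET | e <- orbit (disc_succ f) (arc0 P)].
Proof.
rewrite /walk_edges rot1_disc_circuit /disc_circuit.
elim: (orbit _ _) => //= e s ->; congr (_ :: _).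
by case: f => //=; rewrite finset.setUC.
Qed.

Variable adj : rel V.
Hypothesis adj_arc : forall e, adj (tail e) (head e).
Hypothesis adj_sym : symmetric adj.
Hypothesis adj_ends : forall u v, adj u v ->
  exists e, [set u; v]%SET = [set tail e; head e]%SET.

Lemma edgesP X : reflect (exists e, X = [set tail e; head e]%SET) (X \in edges adj).
Proof.
apply: (iffP imsetP) => [[[u v]]|[e ->]].
  by rewrite inE => /adj_ends[e uv] ->; exists e.
by exists (tail e, head e); rewrite // inE; exact: adj_arc.
Qed.

Lemma uniq_walk_edges_disc f : uniq (walk_edges (disc_circuit f)).
Proof. by rewrite walk_edges_disc map_inj_uniq ?orbit_uniq//; exact: ends_inj. Qed.

Lemma circuit_disc f : circuit adj (disc_circuit f).
Proof.
apply/and3P; split; last exact: uniq_walk_edges_disc.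
  by rewrite -size_eq0 size_disc_circuit -lt0n (leq_trans _ (card_arcs_ge4 P)).
rewrite cycle_map; apply: sub_cycle (cycle_orbit (@disc_succ_inj f) _).
move=> e e' /= /eqP <-; rewrite first_disc_succ.
by case: f => /=; rewrite ?(adj_sym (head e)) adj_arc.
Qed.

Lemma circuit_decomposition_disc f : circuit_decomposition adj [:: disc_circuit f].
Proof.
rewrite /circuit_decomposition /= circuit_disc cats0 /=.
apply: uniq_perm; [exact: uniq_walk_edges_disc|exact: enum_uniq|move=> X].
rewrite mem_enum walk_edges_disc; apply/mapP/edgesP => [[e _ ->]|[e ->]].
  by exists e.
by exists e => //; rewrite -fconnect_orbit disc_cycle.
Qed.

End EulerTriangulation.

(** * The biembedding of a pair of Eulerian circuits *)

Section Homeomorphisms.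

Lemma within_continuous_composition (X Y Z : topologicalType) (A : set X)
    (B : set Y) (f : X -> Y) (g : Y -> Z) : {homo f : x / A x >-> B x} ->
  {within A, continuous f} -> {within B, continuous g} ->
  {within A, continuous (g \o f)}.
Proof.
move=> fAB /subspace_continuousP cf /subspace_continuousP cg.
apply/subspace_continuousP => x Ax U gU.
have h := cg _ (fAB _ Ax) _ gU.
have := cf _ Ax _ h; rewrite /fmap /within /= /nbhs /=.
by apply: filterS => y /= hy Ay; apply: hy => //; exact: fAB.
Qed.

Lemma homeo_between_sym (X Y : topologicalType) (A : set X) (B : set Y) f g :
  homeo_between A B f g -> homeo_between B A g f.
Proof. by move=> [h1 h2 h3 h4 [h5 h6]]; split. Qed.

Lemma homeo_between_trans (X Y Z : topologicalType) (A : set X) (B : set Y)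
    (D : set Z) f g f' g' :
  homeo_between A B f g -> homeo_between B D f' g' ->
  homeo_between A D (f' \o f) (g \o g').
Proof.
move=> [fA gB gK fK [cf cg]] [fA' gB' gK' fK' [cf' cg']]; split.
- by move=> x Ax; apply: fA'; exact: fA.
- by move=> x Dx; apply: gB; exact: gB'.
- by move=> x Ax /=; rewrite gK' ?gK//; exact: fA.
- by move=> x Dx /=; rewrite fK ?fK'//; exact: gB'.
- split; first exact: within_continuous_composition cf cf'.
  exact: within_continuous_composition cg' cg.
Qed.

(** The component meets [B] in a subset that is both open and, through the complement of [D], closed
    in it. *)
Lemma connected_component_clopen (T : topologicalType) (A B D : set T) x :
  connected B -> open B -> open D -> A = B `|` D -> B `&` D = set0 -> B x ->
  connected_component A x = B.
Proof.
move=> cB oB oD AE BD Bx; apply/seteqP; split.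
  have CA : connected_component A x `<=` A by exact: connected_component_sub.
  have Ax : A x by rewrite AE; left.
  have eqC : connected_component A x `&` B = connected_component A x.
    apply: (component_connected (A := A) (x := x)).
    - by exists x; split => //; exact: connected_component_refl.
    - by exists B.
    - exists (~` D); first exact: open_closedC.
      apply/seteqP; split => y [Cy By]; split => //.
        by move=> Dy; have : (B `&` D) y by []; rewrite BD.
      by have := CA _ Cy; rewrite AE => -[].
  by rewrite -eqC => y [].
by apply: connected_component_max => //; rewrite AE => y By; left.
Qed.

End Homeomorphisms.

Section Biembedding.
Variables (R : realType) (V E : finType) (P : euler_pair V E) (adj : rel V).
Hypothesis adj_arc : forall e, adj (tail P e) (head P e).
Hypothesis adj_sym : symmetric adj.
Hypothesis adj_ends : forall u v, adj u v ->
  exists e, [set u; v]%SET = [set tail P e; head P e]%SET.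
Hypothesis even_arcs : ~~ odd #|E|.
Implicit Types (e : E) (f : bool) (v : V) (s : R).

Local Notation K := (euler_triangulation P).
Local Notation S := (glued R K).
Local Notation tail := (tail P).
Local Notation head := (head P).
Local Notation graph := (@realization R V adj).
Local Notation point_of := (@point_of R _ _ K).
Local Notation disc f := (@star R _ _ K (inr f)).

(** The values of [point_of] when the centre has weight 0: only the coordinates of graph edges
    survive, and they are products of two vertex weights. *)
Definition graph_point (x : {ptws V -> R}) :
    {ptws ((V + bool) + tcorner E)%type -> R} := fun i =>
  match i with
  | inl (inl v) => x v
  | inr (_, e, Some false) => x (tail e) * x (head e)
  | _ => 0
  end.

Lemma edge_point_ends u v s : u != v ->
  edge_point u v s u = 1 - s /\ edge_point u v s v = s.
Proof.
move=> uv; rewrite /edge_point !eqxx (negbTE uv) (eq_sym v) (negbTE uv).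
by rewrite !mulr0 !mulr1 addr0 add0r.
Qed.

Lemma graph_point_edge f e s :
  graph_point (edge_point (first_end P f e) (second_end P f e) s) =
  point_of (f, e, None) 0 (1 - s) s.
Proof.
apply/funext => -[[v|b]|c] /=.
- by rewrite mul0r add0r.
- by rewrite !mulr0 mul0r !addr0.
rewrite !mul0r mulr0 mul0r add0r addr0 /side /=.
case: c => [[f' e'] [[]|]] /=; rewrite ?xpair_eqE ?andbF ?mulr0//= !andbT.
have -> : (f' == f) && (e' == e) || (f' == ~~ f) && (e' == e) = (e' == e).
  by case: (e' == e); rewrite ?andbF// !andbT; case: f' f => [] [].
have [->|ne] := eqVneq e' e.
  have [E1 E2] := edge_point_ends s (first_neq_second P f e).
  by rewrite mulr1; case: f E1 E2 => /= -> ->; rewrite // mulrC.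
rewrite mulr0 /edge_point.
(* For another arc [e'] the product must vanish, so one end of [e'] has to lie off [e]; otherwise
   both arcs would have the same ends. *)
have [te|nte] := boolP (tail e' \in [set tail e; head e]%SET); last first.
  move: nte; rewrite !inE negb_or => /andP[/negbTE n1 /negbTE n2].
  by case: f => /=; rewrite n1 n2 !mulr0 addr0 mul0r.
have [he|nhe] := boolP (head e' \in [set tail e; head e]%SET); last first.
  move: nhe; rewrite !inE negb_or => /andP[/negbTE n1 /negbTE n2].
  by case: f => /=; rewrite n1 n2 !mulr0 addr0 mulr0.
case/eqP: ne; apply: (@ends_inj _ _ P); apply/eqP.
rewrite eqEcard !cards2 !tail_neq_head andbT.
by apply/fintype.subsetP => u; rewrite in_set2 => /orP[] /eqP ->.
Qed.

Lemma cell_edge e (x : {ptws V -> R}) : cell [set tail e; head e]%SET x ->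
  exists s, 0 <= s <= 1 /\ x = edge_point (tail e) (head e) s.
Proof.
move=> [x0 x1 xN]; have th := tail_neq_head P e.
have xE v : v != tail e -> v != head e -> x v = 0.
  by move=> v1 v2; apply: xN; rewrite !inE negb_or v1 v2.
have sE : x (tail e) + x (head e) = 1.
  rewrite -x1 (bigD1 (tail e))//= (bigD1 (head e)) ?(eq_sym (head e))//= big1 ?addr0//.
  by move=> v /andP[v1 v2]; exact: xE.
exists (x (head e)); split.
  by rewrite x0/= -sE lerDr.
have tE : 1 - x (head e) = x (tail e) by rewrite -sE addrK.
apply/funext => v; rewrite /edge_point tE.
have [->|v1] := eqVneq v (tail e); first by rewrite (negbTE th) mulr1 mulr0 addr0.
have [->|v2] := eqVneq v (head e); first by rewrite mulr0 mulr1 add0r.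
by rewrite xE// !mulr0 addr0.
Qed.

Lemma cell_edge_point e s : 0 <= s <= 1 ->
  cell [set tail e; head e]%SET (edge_point (tail e) (head e) s : {ptws V -> R}).
Proof.
move=> /andP[s0 s1]; have th := tail_neq_head P e.
have [E1 E2] := edge_point_ends s th.
have E0 v : v != tail e -> v != head e -> edge_point (tail e) (head e) s v = 0.
  by move=> /negbTE v1 /negbTE v2; rewrite /edge_point v1 v2 !mulr0 addr0.
split.
- by move=> v; rewrite /edge_point addr_ge0 ?mulr_ge0//; lra.
- rewrite (bigD1 (tail e))//= (bigD1 (head e)) ?(eq_sym (head e))//= big1 ?addr0.
    by rewrite E1 E2; ring.
  by move=> v /andP[v1 v2]; exact: E0.
- by move=> v; rewrite !inE negb_or => /andP[v1 v2]; exact: E0.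
Qed.

(** No vertex is isolated: each lies on the edge of its [arc_into]. *)
Lemma realizationP (x : {ptws V -> R}) : graph x <->
  exists e s, 0 <= s <= 1 /\ x = edge_point (tail e) (head e) s.
Proof.
split.
  case=> [[v [x0 x1 xN]]|[X /(edgesP adj_arc adj_ends)[e ->] /cell_edge[s h]]].
    exists (arc_into P v); apply: cell_edge; split => // u.
    by rewrite head_arc_into !inE negb_or => /andP[_ uv]; apply: xN; rewrite inE.
  by exists e, s.
move=> [e [s [s01 ->]]]; right; exists [set tail e; head e]%SET.
  by apply/(edgesP adj_arc adj_ends); exists e.
exact: cell_edge_point.
Qed.

Lemma continuous_graph_point : continuous graph_point.
Proof.
apply: continuous_ptws => -[[v|b]|[[b e] [[]|]]] /=.
- exact: real_continuous_proj.
- exact: real_continuous_cst.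
- exact: real_continuous_cst.
- by apply: real_continuousM; exact: real_continuous_proj.
- exact: real_continuous_cst.
Qed.

Lemma simplex_edge s : 0 <= s <= 1 -> simplex 0 (1 - s) s.
Proof. by move=> /andP[s0 s1]; split => //; lra. Qed.

Lemma body_graph_point x : graph x -> @body R _ _ K (graph_point x).
Proof.
move=> /realizationP[e [s [s01 ->]]]; rewrite (graph_point_edge true).
by exists (true, e, None), 0, (1 - s), s; split => //; exact: simplex_edge.
Qed.

Definition graph_embedding (x : {ptws V -> R}) : S :=
  insubd (star_inv K (inr true) (0, 0)) (graph_point x).
Local Notation phi := graph_embedding.

Lemma val_graph_embedding x : graph x -> \val (phi x) = graph_point x.
Proof. by move=> gx; rewrite /phi insubdK//; apply/mem_set/body_graph_point. Qed.

Lemma embedding_graph : embedding adj phi.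
Proof.
split.
  apply: within_continuous_insubd; first exact: body_graph_point.
  by apply: continuous_subspaceT; exact: continuous_graph_point.
move=> x y /set_mem gx /set_mem gy /(congr1 (fun z => \val z)).
rewrite !val_graph_embedding// => xy; apply/funext => v.
exact: (congr1 (fun z : {ptws _ -> R} => z (inl (inl v))) xy).
Qed.

Lemma graph_edge e s : 0 <= s <= 1 -> graph (edge_point (tail e) (head e) s).
Proof. by move=> s01; apply/realizationP; exists e, s. Qed.

Lemma graph_side f e s : 0 <= s <= 1 ->
  graph (edge_point (first_end P f e) (second_end P f e) s).
Proof.
case: f => s01; first exact: graph_edge.
rewrite (_ : edge_point _ _ _ = edge_point (tail e) (head e) (1 - s)).
  by apply: graph_edge; apply/andP; case/andP: s01 => ? ?; split; lra.
by apply/funext => v; rewrite /edge_point /=; ring.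
Qed.

Lemma center_triangle (x : S) : exists f e t0 t1 t2,
  simplex t0 t1 t2 /\ \val x = point_of (f, e, None) t0 t1 t2.
Proof.
have [[[f e] k] [t0 [t1 [t2 [[p0 p1 p2 p3] xE]]]]] := glued_body x.
case: k xE => [[]|] xE.
- exists f, e, t1, t2, t0; split; first by split => //; lra.
  by rewrite xE -(point_of_nextc K (f, e, Some true)).
- exists f, e, t2, t0, t1; split; first by split => //; lra.
  by rewrite xE -(point_of_nextc K (f, e, Some false)) -(point_of_nextc K (f, e, Some true)).
- by exists f, e, t0, t1, t2.
Qed.

Lemma center_weight f f' e t0 t1 t2 :
  point_of (f, e, None) t0 t1 t2 (inl (inr f')) = t0 * (f' == f)%:R.
Proof. by rewrite /= !mulr0 !addr0. Qed.

Lemma disc_disjoint f : disc f `&` disc (~~ f) = set0.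
Proof.
apply/seteqP; split => // x; rewrite /star /= => -[].
have [f' [e [t0 [t1 [t2 [_ ->]]]]]] := center_triangle x.
by rewrite !center_weight; case: f' f => [] []; rewrite ?mulr0 ?ltxx.
Qed.

(** A point at which the centre of its triangle has weight 0 lies on the graph edge of that
    triangle. *)
Lemma complement_graph f : ~` (phi @` graph) = disc f `|` disc (~~ f).
Proof.
apply/seteqP; split => x.
  move=> xN; have [f' [e [t0 [t1 [t2 [[p0 p1 p2 p3] xE]]]]]] := center_triangle x.
  have t00 : 0 < t0.
    rewrite lt_def p0 andbT; apply/eqP => t00; apply: xN.
    have t2E : 0 <= t2 <= 1 by apply/andP; split => //; lra.
    exists (edge_point (first_end P f' e) (second_end P f' e) t2); first exact: graph_side.
    apply/val_inj; rewrite val_graph_embedding; last exact: graph_side.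
    by rewrite graph_point_edge xE t00; congr point_of; lra.
  have h : disc f' x by rewrite /star /= xE center_weight eqxx mulr1.
  by have [<-|ff] := eqVneq f' f; [left|right; rewrite (_ : ~~ f = f')//; case: f f' ff {xE h} => [] []].
move=> xf [y gy yx]; move: xf.
have h f' : ~ disc f' x by rewrite /star /= -yx val_graph_embedding//= ltxx.
by case; exact: h.
Qed.

Lemma connected_disc f : connected (disc f).
Proof.
have [h1 h2 h3 h4 [h5 h6]] := star_homeo R K (inr f).
have -> : disc f = star_inv K (inr f) @` [set z | @gauge R (deg K (inr f)) z < 1].
  apply/seteqP; split => x; last by move=> [z sz <-]; exact: h2.
  by move=> xf; exists (star_map K (inr f) (\val x)); [exact: h1|exact: h3].
apply: connected_continuous_connected h6.
exact: connected_gauge (deg_ge4 K (inr f)).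
Qed.

Lemma component_disc f x : disc f x -> connected_component (~` (phi @` graph)) x = disc f.
Proof.
move=> xf; rewrite (complement_graph f).
apply: (connected_component_clopen (D := disc (~~ f))) => //.
- exact: connected_disc.
- exact: open_star.
- exact: open_star.
- exact: disc_disjoint.
Qed.

Lemma center_disc f : disc f (star_inv K (inr f) (0, 0)).
Proof.
have [_ h _ _ _] := star_homeo R K (inr f); apply: h.
by rewrite /= gauge0 ?ltr01 ?deg_ge4.
Qed.

Lemma faceE (F : set S) : face adj phi F <-> exists f, F = disc f.
Proof.
split.
  move=> [x xN ->].
  have [xf|xf] : (disc true `|` disc (~~ true)) x by rewrite -complement_graph.
    by exists true; exact: component_disc.
  by exists false; exact: component_disc.
move=> [f ->]; exists (star_inv K (inr f) (0, 0)).
  by rewrite (complement_graph f); left; exact: center_disc.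
exact/esym/component_disc/center_disc.
Qed.

Lemma cellular_graph : cellular adj phi.
Proof.
move=> F /faceE[f ->].
have [g [g' h]] := homeomorphic_gauge_disc R (deg_ge4 K (inr f)).
by do 2 eexists; exact: homeo_between_trans (star_homeo R K (inr f)) h.
Qed.

(** The parametrization of the star of the centre extends to the closed polygon and maps its [k]-th
    side to the [k]-th arc of the circuit, so it serves as the required map. *)
Lemma bounded_by_disc f : bounded_by phi (disc f) (disc_circuit P f).
Proof.
have d4 := deg_ge4 K (inr f).
have dE : size (disc_circuit P f) = deg K (inr f) by rewrite size_disc_circuit deg_center.
have even_deg : ~~ odd (deg K (inr f)) by rewrite deg_center.
rewrite /bounded_by dE; exists (star_inv K (inr f)).
rewrite (polygonE R d4 even_deg) (interior_gauge R d4); split.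
- exact: continuous_star_inv.
- by eexists; exact: homeo_between_sym (star_homeo R K (inr f)).
move=> v0 k s kd; rewrite in_itv/= => s01.
have [s0 s1] : 0 <= 1 - s /\ 0 <= s by case/andP: s01 => ? ?; split; lra.
rewrite -[side_point _ _ _]/(sect (deg K (inr f)) k (1 - s) s).
have ks : (k < size (orbit (disc_succ P f) (arc0 P)))%N.
  by rewrite -(size_map (first_end P f)) dE.
rewrite rot1_disc_circuit /disc_circuit !(nth_map (arc0 P))//.
set e := nth _ _ k.
have eE : around K (inr f) k = (f, e, None).
  by rewrite around_center /e /orbit nth_traject// -size_orbit.
apply/val_inj; rewrite val_graph_embedding; last exact: graph_side.
rewrite val_star_inv; last by rewrite gauge_sect// subrK.
by rewrite star_param_sect// graph_point_edge eE subrK subrr.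
Qed.

Lemma biembedding_discs :
  biembedding adj phi [:: disc_circuit P true] [:: disc_circuit P false].
Proof.
split; [exact: embedding_graph|exact: circuit_decomposition_disc..|].
have col f : `[< disc f = disc true >] = f.
  case: f; first exact/asboolP.
  apply/asboolP => df; have : (disc true `&` disc (~~ true)) (star_inv K (inr true) (0, 0)).
    by split => /=; rewrite ?df; exact: center_disc.
  by rewrite disc_disjoint.
exists (fun F => `[< F = disc true >]); split.
- move=> F G /faceE[f ->] /faceE[f' ->] FG _; rewrite !col => ff'.
  by apply: FG; rewrite ff'.
- split => [F /faceE[f ->]|C].
    by rewrite col => ->; exists (disc_circuit P true); rewrite ?inE//; exact: bounded_by_disc.
  rewrite inE => /eqP ->; exists (disc true); split; [|exact: col|exact: bounded_by_disc].
  by apply/faceE; exists true.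
- split => [F /faceE[f ->]|C].
    by rewrite col => ->; exists (disc_circuit P false); rewrite ?inE//; exact: bounded_by_disc.
  rewrite inE => /eqP ->; exists (disc false); split; [|exact: col|exact: bounded_by_disc].
  by apply/faceE; exists false.
Qed.

Lemma face_length_discs F : face adj phi F -> face_length adj phi F #|E|.
Proof.
move=> /faceE[f ->]; exists (disc_circuit P f); split.
- exact: circuit_disc.
- exact: bounded_by_disc.
- exact: size_disc_circuit.
Qed.

Lemma connected_glued_discs : connected [set: S].
Proof.
(* The white arc is chosen so that its head is the tail of [arc0], a vertex common to both discs. *)
apply: (@connected_glued R _ _ K (inr true) (inr false) (true, arc0 P, None)
  (false, disc_succ P false (arc0 P), None)) => //.
  exact: (congr1 inl (esym (first_disc_succ P false (arc0 P)))).
move=> [[f e] k]; exists (f, e, None); split; first by case: f; rewrite !inE eqxx ?orbT.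
by case: k => [[]|]; [right; left|right; right|left].
Qed.

End Biembedding.

(** * Circuits with cyclic labels *)

Section SkewProduct.
Variables (Z : finZmodType) (L : finType) (a : L -> Z) (p : L -> L) (r0 : L).
Hypothesis p_inj : injective p.
Hypothesis p_cycle : forall r, fconnect p r0 r.

(** An arc is recorded by its tail in [Z] and the index of its label; the next arc starts where this
    one ends and takes the index given by [p]. *)
Definition skew (e : Z * L) : Z * L := (e.1 + a e.2, p e.2).

Lemma skew_inj : injective skew.
Proof. by move=> [g r] [g' r'] [+ /p_inj rr]; rewrite /= rr => /addIr ->. Qed.

Lemma iter_skew g k :
  iter k skew (g, r0) = (g + \sum_(i < k) a (iter i p r0), iter k p r0).
Proof.
elim: k => [|k IH]; first by rewrite big_ord0 addr0.
by rewrite iterS IH /skew/= big_ord_recr addrA.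
Qed.

Lemma sum_cycle : \sum_(i < order p r0) a (iter i p r0) = \sum_r a r.
Proof.
have o : perm_eq (orbit p r0) (index_enum L).
  apply: uniq_perm; [exact: orbit_uniq|exact: index_enum_uniq|move=> r].
  by rewrite -fconnect_orbit p_cycle mem_index_enum.
rewrite -(perm_big _ o)/= /orbit (big_nth r0) size_traject big_mkord.
by apply: eq_bigr => i _; rewrite nth_traject.
Qed.

(* One turn around the labels translates by the sum of all labels. *)
Lemma skew_cycle g0 : (forall g, exists k, g = (\sum_r a r) *+ k) ->
  forall e, fconnect skew (g0, r0) e.
Proof.
move=> gen [g r]; set t := findex p r0 r.
have [k kE] := gen (g - (g0 + \sum_(i < t) a (iter i p r0))).
have turn j : iter (j * order p r0) skew (g0, r0) = (g0 + (\sum_r a r) *+ j, r0).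
  elim: j => [|j IH]; first by rewrite mulr0n addr0.
  by rewrite mulSn iterD IH iter_skew sum_cycle iter_order// mulrSr addrA.
have -> : (g, r) = iter (t + k * order p r0) skew (g0, r0).
  rewrite iterD turn iter_skew iter_findex//; congr pair.
  by rewrite -kE addrAC addrC subrK.
exact: fconnect_iter.
Qed.

End SkewProduct.

(* Signs + - - + on 2, 3, 4, 5 and so on: the labels then add up to 1. *)
Definition signed_label (A : comNzRingType) (r : nat) : A :=
  if (1 < r %% 4)%N then - r.+1%:R else r.+1%:R.

Lemma sum_signed_label (A : comNzRingType) k :
  \sum_(r < (4 * k).+1) signed_label A r = 1.
Proof.
elim: k => [|k IH]; first by rewrite big_ord_recl big_ord0 addr0.
rewrite (_ : (4 * k.+1).+1 = (4 * k).+1.+4)%N; last by lia.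
rewrite 4!big_ord_recr /= IH /signed_label.
have -> : ((4 * k).+1 %% 4 = 1)%N by lia.
have -> : ((4 * k).+2 %% 4 = 2)%N by lia.
have -> : ((4 * k).+3 %% 4 = 3)%N by lia.
have -> : ((4 * k).+4 %% 4 = 0)%N by lia.
rewrite -4!natr1 /=; ring.
Qed.

(** * Labelled arcs between residues modulo [N] *)

Section CyclicLabels.
Variable q : nat.
Local Notation M := (4 * q).+1.
(** The shape [_.+2] is what gives ['I_N] its ring structure. *)
Local Notation N := (2 * M).+2.
Local Notation Z := 'I_N.
Local Notation L := 'I_M.
Local Notation V := ('I_(M + 1) * 'I_2)%type.

Definition shift2 : L -> L := @ordS M \o @ordS M.

Lemma val_iter_ordS k (r : L) : iter k (@ordS M) r = ((r + k) %% M)%N :> nat.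
Proof.
elim: k => [|k IH]; first by rewrite addn0 modn_small.
by rewrite iterS /= IH addnS -addn1 modnDml addn1.
Qed.

Lemma ordS_cycle (r r' : L) : fconnect (@ordS M) r r'.
Proof.
have from0 s : fconnect (@ordS M) ord0 s.
  rewrite (_ : s = iter s (@ordS M) ord0) ?fconnect_iter//.
  by apply/ord_inj; rewrite val_iter_ordS add0n modn_small.
by apply: connect_trans (from0 r'); rewrite (fconnect_sym (@ordS_inj M)).
Qed.

Lemma shift2_cycle (r : L) : fconnect shift2 ord0 r.
Proof.
have iter2 k : iter k shift2 ord0 = iter k.*2 (@ordS M) ord0.
  by elim: k => //= k ->.
have [k kE] : exists k, r = (k.*2 %% M)%N :> nat.
  (* As [M] is odd, one of [r] and [r + M] is even. *)
  have [rodd|reven] := boolP (odd r).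
    exists (r + M)./2; rewrite even_halfK ?modnDr ?modn_small//.
    by rewrite oddD rodd /= oddM.
  by exists r./2; rewrite even_halfK// modn_small.
rewrite (_ : r = iter k shift2 ord0) ?fconnect_iter//.
by apply/ord_inj; rewrite iter2 val_iter_ordS add0n.
Qed.

Local Notation label := (signed_label Z).

Lemma val_add_nat (x : Z) k : x + k%:R = ((x + k) %% N)%N :> nat.
Proof.
have h : (k%:R : Z) = (k %% N)%N :> nat by exact: (@val_Zp_nat N).
by rewrite -[LHS]/((x + (k%:R : Z)) %% N)%N h modnDmr.
Qed.

Lemma modn_vertex m : (m %% N %% (M + 1) = m %% (M + 1))%N.
Proof. by rewrite modn_dvdm// (_ : N = 2 * (M + 1))%N ?dvdn_mull//; lia. Qed.

Lemma vertex_of_proof1 (x : Z) : (x %% (M + 1) < M + 1)%N.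
Proof. by rewrite ltn_mod addn1. Qed.

Lemma vertex_of_proof2 (x : Z) : (x %/ (M + 1) < 2)%N.
Proof. by rewrite ltn_divLR ?addn1//; have := ltn_ord x; lia. Qed.

(** Since [M + 1] is half of [N], the two vertices of a part are a residue and its translate by
    [N / 2]. *)
Definition vertex_of (x : Z) : V :=
  (Ordinal (vertex_of_proof1 x), Ordinal (vertex_of_proof2 x)).

Lemma val_vertex1 x : (vertex_of x).1 = (x %% (M + 1))%N :> nat.
Proof. by []. Qed.

Lemma vertex_of_inj : injective vertex_of.
Proof.
move=> x y [xy1 xy2]; apply/val_inj => /=.
by rewrite (divn_eq x (M + 1)) (divn_eq y (M + 1)) xy1 xy2.
Qed.

Definition residue_of (v : V) : Z := inord (v.2 * (M + 1) + v.1).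

Lemma residue_ofK : cancel residue_of vertex_of.
Proof.
move=> [i j]; have iM := ltn_ord i; have jd := ltn_ord j.
have j1 : (j * (M + 1) <= 1 * (M + 1))%N by rewrite leq_mul2r -ltnS jd orbT.
have v : residue_of (i, j) = (j * (M + 1) + i)%N :> nat by rewrite inordK//=; lia.
congr pair; apply/val_inj; rewrite /= v; first by rewrite modnMDl modn_small.
rewrite divnMDl; last by rewrite addn1.
by rewrite divn_small ?addn0.
Qed.

Lemma vertex_of_shift (x : Z) k : (0 < k <= M)%N ->
  (vertex_of (x + k%:R)).1 != (vertex_of x).1.
Proof.
move=> /andP[k0 kM]; apply/eqP => /(congr1 (@nat_of_ord _)).
rewrite !val_vertex1 val_add_nat modn_vertex => /eqP.
rewrite -[X in _ == (X %% _)%N]addn0 eqn_modDl mod0n modn_small ?addn1//.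
by case: k k0 {kM}.
Qed.

(** The difference of the residues is neither 0 nor [M + 1], so it or its negative lies between 1
    and [M]. *)
Lemma shift_exists (x y : Z) : (vertex_of x).1 != (vertex_of y).1 ->
  exists k, (0 < k <= M)%N /\ (y = x + k%:R \/ x = y + k%:R).
Proof.
move=> xy; set d : Z := y - x.
have yE : y = x + (d : nat)%:R by rewrite (natr_Zp (d : 'Z_N)) /d addrC subrK.
have dN := ltn_ord d.
have d0 : (d : nat) != 0%N.
  by apply: contraNneq xy => d0; rewrite yE d0 addr0.
have dM : (d : nat) != (M + 1)%N.
  apply: contraNneq xy => dM; apply/eqP/ord_inj; rewrite yE dM.
  by rewrite !val_vertex1 val_add_nat modn_vertex modnDr.
have [dle|dgt] := leqP d M; first by exists d; split; [lia|left].
exists (N - d)%N; split; first by lia.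
right; rewrite natrB ?(ltnW dN)// (_ : N%:R = 0); last first.
  by apply/ord_inj; rewrite (@val_Zp_nat N)// modnn.
by rewrite [in RHS]yE; ring.
Qed.

Lemma natr_small_eq k l : (0 < k <= M)%N -> (0 < l <= M)%N ->
  (k%:R : Z) = l%:R -> k = l.
Proof.
move=> kM lM /(congr1 (fun x : Z => x : nat)).
by rewrite !(@val_Zp_nat N)// !modn_small//; lia.
Qed.

Lemma natr_small_neq0 k l : (0 < k <= M)%N -> (0 < l <= M)%N ->
  (k%:R : Z) + l%:R != 0.
Proof.
move=> kM lM; rewrite -natrD; apply/eqP => /(congr1 (fun x : Z => x : nat)).
by rewrite (@val_Zp_nat N)// modn_small/=; lia.
Qed.

Lemma pair_set2 (T : finType) (u v u' v' : T) : u != v ->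
  [set u; v]%SET = [set u'; v']%SET -> u = u' /\ v = v' \/ u = v' /\ v = u'.
Proof.
move=> uv e; have hu : u \in [set u'; v']%SET by rewrite -e set21.
have hv : v \in [set u'; v']%SET by rewrite -e set22.
move: hu hv uv; rewrite !inE => /orP[] /eqP -> /orP[] /eqP ->;
  by rewrite ?eqxx//; auto.
Qed.

Definition arc_label (r : L) : Z := label r.

Lemma label_natr (r : L) : arc_label r = r.+1%:R \/ arc_label r = - r.+1%:R.
Proof. by rewrite /arc_label /signed_label; case: ifP; auto. Qed.

Lemma label_range (r : L) : (0 < r.+1 <= M)%N.
Proof. by rewrite ltn_ord. Qed.

Lemma label_inj : injective arc_label.
Proof.
move=> r r' rr; have lr := label_range r; have lr' := label_range r'.
have bad k l : (0 < k <= M)%N -> (0 < l <= M)%N -> (k%:R : Z) <> - l%:R.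
  by move=> kM lM e; have := natr_small_neq0 kM lM; rewrite e addNr eqxx.
apply/ord_inj/succn_inj; apply: (natr_small_eq lr lr').
case: (label_natr r) (label_natr r') rr => -> [] -> // e.
- by case: (bad _ _ lr lr').
- by case: (bad _ _ lr' lr).
- exact: oppr_inj.
Qed.

Lemma label_add_neq0 (r : L) : arc_label r + arc_label r != 0.
Proof.
have lr := label_range r; have h := natr_small_neq0 lr lr.
by case: (label_natr r) => ->; rewrite // -opprD oppr_eq0.
Qed.

Lemma label_opp (r r' : L) : arc_label r + arc_label r' = 0 -> r = r'.
Proof.
have lr := label_range r; have lr' := label_range r' => e.
apply/ord_inj/succn_inj; apply: (natr_small_eq lr lr').
have h := natr_small_neq0 lr lr'.
move: e; case: (label_natr r) (label_natr r') => -> [] ->.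
- by move=> e; move: h; rewrite e eqxx.
- by move/eqP; rewrite subr_eq0 => /eqP.
- by move/eqP; rewrite addrC subr_eq0 => /eqP.
- by rewrite -opprD => /eqP; rewrite oppr_eq0 (negbTE h).
Qed.

Definition arc_tail (e : Z * L) : V := vertex_of e.1.
Definition arc_head (e : Z * L) : V := vertex_of (e.1 + arc_label e.2).

Definition arc_black := skew arc_label (@ordS M).
Definition arc_white := skew arc_label shift2.

Lemma arc_adj e : (arc_tail e).1 != (arc_head e).1.
Proof.
case: e => g r; rewrite /arc_tail /arc_head /=; have lr := label_range r.
case: (label_natr r) => ->; first by rewrite eq_sym vertex_of_shift.
by have := vertex_of_shift (g - r.+1%:R) lr; rewrite subrK.
Qed.

(** The distance between the residues selects the label, and the sign of the label selects which end
    is the tail. *)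
Lemma arc_ends (u v : V) : u.1 != v.1 ->
  exists e, [set u; v]%SET = [set arc_tail e; arc_head e]%SET.
Proof.
rewrite -(residue_ofK u) -(residue_ofK v) => /shift_exists.
move: (residue_of u) (residue_of v) => x y [k [kM xy]].
have kL : (k.-1 < M)%N by lia.
have kE : k.-1.+1 = k by lia.
have main z w : w = z + k%:R -> exists e : Z * L,
    [set vertex_of z; vertex_of w]%SET = [set arc_tail e; arc_head e]%SET.
  move=> wE; have := label_natr (Ordinal kL); rewrite /= kE => -[lE|lE].
    by exists (z, Ordinal kL); rewrite /arc_tail /arc_head /= lE wE.
  exists (w, Ordinal kL); rewrite /arc_tail /arc_head /= lE wE addrK.
  exact: finset.setUC.
case: xy => [/main//|/main[e eE]].
by exists e; rewrite finset.setUC.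
Qed.

(** Two arcs running oppositely along one edge would have opposite labels. These have equal absolute
    value, hence are the same label, whose double would vanish although its absolute value is below
    [N / 2]. *)
Lemma arc_ends_inj : injective (fun e => [set arc_tail e; arc_head e]%SET).
Proof.
move=> [g r] [g' r'] /pair_set2; rewrite /arc_tail /arc_head /=.
have ne : vertex_of g != vertex_of (g + arc_label r).
  apply: contraNneq (arc_adj (g, r)).
  by rewrite -[arc_tail _]/(vertex_of g) => ->; exact: eqxx.
case/(_ ne) => -[/vertex_of_inj e1 /vertex_of_inj e2].
  by move: e2; rewrite e1 => /addrI/label_inj ->.
have rr : arc_label r' + arc_label r = 0.
  by apply: (addrI g'); rewrite addrA -e1 e2 addr0.
by have := label_add_neq0 r; rewrite -{1}(label_opp rr) rr eqxx.
Qed.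

(** At a fixed head [h] an incoming arc is determined by its label index. From index [s], [white]
    leads to the arc leaving [h] with index [s + 2], and undoing [black] leads back to index
    [s + 1]; so all indices occur in turn. *)
Lemma arc_rotation e e' : arc_head e = arc_head e' ->
  fconnect (finv arc_black \o arc_white) e e'.
Proof.
case: e e' => g r [g' r'] /vertex_of_inj /= gE.
have bI : injective arc_black by apply: skew_inj; exact: ordS_inj.
have step h s : (finv arc_black \o arc_white) (h - arc_label s, s) =
    (h - arc_label (ordS s), ordS s).
  apply: (canLR (finv_f bI)); rewrite /arc_white /arc_black /skew /=.
  by rewrite !subrK.
have iterE h k : iter k (finv arc_black \o arc_white) (h - arc_label r, r) =
    (h - arc_label (iter k (@ordS M) r), iter k (@ordS M) r).
  by elim: k => // k IH; rewrite iterS IH step.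
have -> : (g, r) = (g + arc_label r - arc_label r, r) by rewrite addrK.
have -> : (g', r') = iter (findex (@ordS M) r r') (finv arc_black \o arc_white)
    (g + arc_label r - arc_label r, r).
  by rewrite iterE iter_findex ?ordS_cycle// gE addrK.
exact: fconnect_iter.
Qed.

Lemma sum_arc_label (g : Z) : exists k, g = (\sum_r arc_label r) *+ k.
Proof. by exists g; rewrite (sum_signed_label Z q) (natr_Zp (g : 'Z_N)). Qed.

Definition arc_into_vertex (v : V) : Z * L :=
  (residue_of v - arc_label ord0, ord0).

Lemma arc_head_into v : arc_head (arc_into_vertex v) = v.
Proof. by rewrite /arc_head /= subrK residue_ofK. Qed.

Lemma card_arcs : #|{: Z * L}| = (N * M)%N.
Proof. by rewrite card_prod !card_ord. Qed.

Definition arc_pair : euler_pair V (Z * L)%type.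
Proof.
apply: (@EulerPair _ _ arc_tail arc_head arc_black arc_white _ _ _ _ (0, ord0) _ _
  arc_rotation arc_ends_inj _ _ arc_head_into).
- by apply: skew_inj; exact: ordS_inj.
- by apply: skew_inj => r r' /ordS_inj/ordS_inj.
- by [].
- by [].
- by apply: skew_cycle sum_arc_label; [exact: ordS_inj|exact: ordS_cycle].
- apply: skew_cycle sum_arc_label; last exact: shift2_cycle.
  by move=> r r' /ordS_inj/ordS_inj.
- by move=> e; apply: contraNneq (arc_adj e) => ->.
- by rewrite card_arcs; lia.
Defined.

End CyclicLabels.

Theorem proposition5p7 (R : realType) (n : nat) (n_ge1 : (1 <= n)%N)
    (n_odd : odd n) :
  exists (S : topologicalType)
         (phi : {ptws 'I_(n ^ 2 + 1) * 'I_2 -> R} -> S),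
    [/\ surface R S, orientable R S,
        exists D D', biembedding (@multipartite (n ^ 2 + 1) 2) phi D D',
        cellular (@multipartite (n ^ 2 + 1) 2) phi &
        forall F : set S, face (@multipartite (n ^ 2 + 1) 2) phi F ->
          exists l : nat,
            face_length (@multipartite (n ^ 2 + 1) 2) phi F l /\
            (l = (4 * n)%N \/ (n * ((n ^ 2 + 1) %/ 2) %| l)%N)].
Proof.
have [q qE] : exists q, (n ^ 2 = (4 * q).+1)%N.
  (* With n = 2k + 1, n^2 = 4k(k + 1) + 1. *)
  exists (n./2 * (n./2).+1)%N; rewrite -{1}(odd_double_half n) n_odd.
  by move: (n./2) => k; rewrite -mulnn; lia.
have len : (n * ((n ^ 2 + 1) %/ 2) %| (2 * n ^ 2).+2 * n ^ 2)%N.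
  apply/dvdnP; exists (4 * n)%N.
  have : (n ^ 2 + 1 = (n ^ 2 + 1) %/ 2 * 2)%N by rewrite qE; lia.
  by move: (_ %/ _)%N => m; nia.
move: len; rewrite qE => len; set M := (4 * q).+1 in len *.
pose P := arc_pair q.
have adj_sym : symmetric (@multipartite (M + 1) 2).
  by move=> x y; rewrite /multipartite eq_sym.
have even_arcs : ~~ odd #|{: 'I_(2 * M).+2 * 'I_M}|.
  by rewrite card_arcs oddM (_ : (2 * M).+2 = M.+1.*2) ?odd_double//; lia.
exists (glued R (euler_triangulation P)), (@graph_embedding R _ _ P); split.
- by apply: surface_glued; exact: connected_glued_discs.
- exact: orientable_glued.
- exists [:: disc_circuit P true], [:: disc_circuit P false].
  by apply: biembedding_discs => //; [exact: arc_adj|exact: arc_ends].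
- by apply: cellular_graph => //; [exact: arc_adj|exact: arc_ends].
- move=> F FF; exists #|{: 'I_(2 * M).+2 * 'I_M}|; split.
    by apply: face_length_discs FF => //; [exact: arc_adj|exact: arc_ends].
  by right; rewrite card_arcs.
Qed.
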